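(* Let $\alpha<1$, $\kappa\le0$, and for $\eta>0$ set $\Gamma(v)=[(\alpha-1)v+1]^{\eta/(1-\alpha)}$ for all $v\in\mathrm{Dom}_\alpha$. Assume that: (1) $\mathsf T$ is a compact metric space and $\mathcal T$ is the associated Borel $\sigma$-field; (2) for all $y\in\mathsf Y$, $\theta\mapsto k(\theta,y)$ is continuous; (3) $\int_{\mathsf Y}\sup_{\theta\in\mathsf T}k(\theta,y)\times\sup_{\theta'\in\mathsf T}\left(\frac{k(\theta',y)}{p(y)}\right)^{\alpha-1}\nu(dy)<\infty$; (4) if $\alpha=0$, in addition $\int_{\mathsf Y}\sup_{\theta\in\mathsf T}\left|\log\left(\frac{k(\theta,y)}{p(y)}\right)\right|p(y)\,\nu(dy)<\infty$. Then for all $\zeta\in\mathrm M_1(\mathsf T)$, any $\eta>0$ satisfies $\zeta(\Gamma(b_{\zeta,\alpha}+\kappa))<\infty$, and $\Psi_\alpha(\zeta)<\infty$. Let $\eta\in(0,1]$. Further assume that there exist $\mu_1,\mu^\star\in\mathrm M_1(\mathsf T)$ such that the (well-defined) sequence $(\mu_n)_{n\ge1}$ given by $\mu_{n+1}=\mathcal I_\alpha(\mu_n)$, $n\ge1$, converges weakly to $\mu^\star$ as $n\to\infty$. Then: (i) $(\Psi_\alpha(\mu_n))_{n\ge1}$ is non-increasing; (ii) $\mu^\star$ is a fixed point of $\mathcal I_\alpha$; (iii) $\Psi_\alpha(\mu^\star)=\inf_{\zeta\in\mathrm M_{1,\mu_1}(\mathsf T)}\Psi_\alpha(\zeta)$.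
   Context: Setting. $(\mathsf T,\mathcal T)$ is a measurable space and $\mathrm M_1(\mathsf T)$ is the set of probability measures on it; $\mathrm M_{1,\mu_1}(\mathsf T)$ is the set of probability measures on $\mathsf T$ dominated by $\mu_1$. $(\mathsf Y,\mathcal Y,\nu)$ is a measured space with $\nu$ $\sigma$-finite. $k$ is a kernel density on $\mathsf T\times\mathsf Y$, i.e. $K(\theta,A)=\int_A k(\theta,y)\,\nu(dy)$ is a Markov transition kernel on $\mathsf T\times\mathcal Y$. $p$ is a measurable function on $\mathsf Y$. It is assumed that $k(\theta,y)>0$ and $p(y)>0$ for all $(\theta,y)$, and $\int_{\mathsf Y}p\,d\nu<\infty$. On $(0,\infty)$: $f_0(u)=u-1-\log u$ and $f_\alpha(u)=\frac{1}{\alpha(\alpha-1)}[u^\alpha-1-\alpha(u-1)]$ for $\alpha\in\mathbb R\setminus\{0,1\}$. For $\mu\in\mathrm M_1(\mathsf T)$: $\mu k(y)=\int_{\mathsf T}\mu(d\theta)k(\theta,y)$; $\Psi_\alpha(\mu)=\int_{\mathsf Y}f_\alpha\left(\frac{\mu k(y)}{p(y)}\right)p(y)\,\nu(dy)$; $b_{\mu,\alpha}(\theta)=\int_{\mathsf Y}k(\theta,y)f_\alpha'\left(\frac{\mu k(y)}{p(y)}\right)\nu(dy)$. For a function $h$, $\mu(h)=\int h\,d\mu$. $\mathrm{Dom}_\alpha$ is an interval of $\mathbb R$ containing $b_{\mu,\alpha}(\theta)+\kappa$ and $\mu(b_{\mu,\alpha})+\kappa$ for all $\theta\in\mathsf T$,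 $\mu\in\mathrm M_1(\mathsf T)$, and on which $(\alpha-1)v+1\ge(\alpha-1)\kappa$. $\mathcal I_\alpha(\mu)(d\theta)=\frac{\mu(d\theta)\,\Gamma(b_{\mu,\alpha}(\theta)+\kappa)}{\mu(\Gamma(b_{\mu,\alpha}+\kappa))}$. *)

(* Defs.v *)
From HB Require Import structures.
From mathcomp Require Import all_boot all_order all_algebra.
From mathcomp Require Import all_classical all_reals all_analysis.

Set Implicit Arguments.
Unset Strict Implicit.
Unset Printing Implicit Defensive.

Import Order.TTheory GRing.Theory Num.Theory.
Import numFieldNormedType.Exports.

Local Open Scope classical_set_scope.
Local Open Scope ring_scope.

(* No compatibility between the metric and the sigma-algebra is built in: that
   the latter is the Borel one is a separate hypothesis. *)
#[short(type="measurableMetricType")]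
HB.structure Definition MeasurableMetric (d : measure_display)
    (R : numDomainType) :=
  {T of Measurable d T & Metric R T}.

Definition is_borel (d : measure_display) (R : realType)
    (T : measurableMetricType d R) : Prop :=
  (measurable : set (set T)) = <<s (open : set (set T)) >>.

Section kernel_density.
Context (d dY : measure_display) (T : measurableType d)
  (Y : measurableType dY) (R : realType).

Definition kernel_density (nu : {measure set Y -> \bar R}) (k : T -> Y -> R) :
    Prop :=
  measurable_fun setT (fun z : T * Y => k z.1 z.2) /\
  exists K : R.-pker T ~> Y, forall (t : T) (A : set Y), measurable A ->
    K t A = (\int[nu]_(y in A) (k t y)%:E)%E.

End kernel_density.

Section weak_convergence.
Context (d : measure_display) (R : realType) (T : measurableMetricType d R).

Definition weakly_converges (mu_ : nat -> probability T R)
    (mu : probability T R) : Prop :=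
  forall g : T -> R, continuous g -> [bounded g t | t in [set: T]] ->
    \int[mu_ n]_t g t @[n --> \oo] --> \int[mu]_t g t.

End weak_convergence.

(* The case alpha = 1 is excluded: the formula then has a zero denominator and
   the value is meaningless. *)
Definition falpha (R : realType) (alpha u : R) : R :=
  if alpha == 0 then u - 1 - ln u
  else (alpha * (alpha - 1))^-1 * (u `^ alpha - 1 - alpha * (u - 1)).

Definition Gamma (R : realType) (alpha eta v : R) : R :=
  ((alpha - 1) * v + 1) `^ (eta / (1 - alpha)).

Section alpha_divergence.
Context (d dY : measure_display) (T : measurableType d)
  (Y : measurableType dY) (R : realType).
Variables (nu : {measure set Y -> \bar R}) (k : T -> Y -> R) (p : Y -> R).
Variable alpha : R.

(* `mixture` and `gradb` are real-valued, whereas the integrals they stand for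
   might a priori be infinite. They are finite when T is compact, k is
   continuous in its first argument and
     \int sup_t k(t, y) sup_t' (k(t', y) / p(y)) ^ (alpha - 1) nu(dy) < +oo:
   k(., y) is then bounded for every y and, for alpha < 1, convexity of
   u |-> u ^ (alpha - 1) bounds k(t, y) (mu k(y) / p(y)) ^ (alpha - 1) by the
   integrand above. *)
Definition mixture (mu : probability T R) (y : Y) : R := \int[mu]_t k t y.

(* Extended-valued, with no integrability requirement: the integrand is
   nonnegative because falpha alpha >= 0 on ]0, +oo[. *)
Definition Psi (mu : probability T R) : \bar R :=
  (\int[nu]_y (falpha alpha (mixture mu y / p y) * p y)%:E)%E.

Definition gradb (mu : probability T R) (t : T) : R :=
  \int[nu]_y (k t y * derive1 (falpha alpha) (mixture mu y / p y)).

Variables (eta kappa : R).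

Definition Gamma_mass (mu : probability T R) : \bar R :=
  (\int[mu]_t (Gamma alpha eta (gradb mu t + kappa))%:E)%E.

(* The measure I_alpha(mu), as a set function meant for measurable sets; it is
   a probability measure when 0 < Gamma_mass mu < +oo. *)
Definition power_descent (mu : probability T R) (A : set T) : \bar R :=
  (\int[mu]_(t in A)
     (Gamma alpha eta (gradb mu t + kappa) / fine (Gamma_mass mu))%:E)%E.

(* mu_ is indexed from 0: mu_ 0, mu_ 1, ... stand for mu_1, mu_2, ... *)
Definition power_descent_seq (mu1 : probability T R)
    (mu_ : nat -> probability T R) : Prop :=
  mu_ 0%N = mu1 /\
  forall (n : nat) (A : set T), measurable A ->
    mu_ n.+1 A = power_descent (mu_ n) A.

End alpha_divergence.

(* Main.v *)
(** Up to its linear part, which integrates to a constant, [falpha alpha] is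
the function [phi] satisfying [phi (u v) = phi u + u^alpha phi v].  With
[score mu t] the integral of [k t y (mu k y / p y)^(alpha - 1)], the density of
the update is a multiple of [(score + (alpha - 1) kappa)^(eta / (1 - alpha))].

- Jensen's inequality applied to [phi] bounds the change of [Psi] under any
  reweighting of [mu] by a density [h] by the integral of [phi h * score]; for
  the power descent a pointwise tangent bound makes it nonpositive.
- Weak convergence and domination give uniform convergence of the scores.
  Testing the recursion against the limit density itself shows that this
  density has zero variance under [mustar], which is thus a fixed point and has
  an almost everywhere constant score.
- A set on which the limit score exceeds that constant is multiplied in mass by
  a factor bounded away from 1 at each late step, so it is [mu1]-null.  Convexity
  of [Psi] then gives the minimality of [mustar]. *)

Require Import Defs.
From HB Require Import structures.
From mathcomp Require Import all_boot all_order all_algebra.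
From mathcomp Require Import all_classical all_reals all_analysis.
From mathcomp Require Import measurable_realfun ring lra.

Set Implicit Arguments.
Unset Strict Implicit.
Unset Printing Implicit Defensive.

Import Order.TTheory GRing.Theory Num.Theory.
Import numFieldNormedType.Exports.

Local Open Scope classical_set_scope.
Local Open Scope ring_scope.

(** * The generator of the alpha-divergence *)

Section real_functions.
Context {R : realType}.
Implicit Types a h u v s r x y e m : R.

(** The additive constant is fixed by [phi a 1 = 0], which the multiplicative rule [phiM] forces. *)
Definition phi (a u : R) : R :=
  if a == 0 then - ln u else (a * (a - 1))^-1 * (u `^ a - 1).

Lemma falphaE a u : a < 1 -> falpha a u = phi a u + (u - 1) / (1 - a).
Proof.
move=> a1; rewrite /falpha /phi; case: eqP => [->|/eqP a0].
  by rewrite subr0 divr1 addrC.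
have a1' : a - 1 != 0 by rewrite subr_eq0 lt_eqF.
have a1'' : 1 - a != 0 by rewrite subr_eq0 gt_eqF.
by field; rewrite a0 a1' a1''.
Qed.

(** One formula serves both branches of [falpha]: at [a = 0] the exponent [a - 1] is -1, and the
    derivative of the logarithm is the inverse. *)
Lemma is_derive_falpha a u : a < 1 -> 0 < u ->
  is_derive u 1 (falpha a) ((a - 1)^-1 * (u `^ (a - 1) - 1)).
Proof.
move=> a1 u0.
have a1' : a - 1 != 0 by rewrite subr_eq0 lt_eqF.
rewrite /falpha; case: eqP => [->|/eqP a0].
  have -> : (fun x : R => x - 1 - ln x) = (id - cst 1) - @ln R :> (R -> R).
    by apply/funext.
  have dln := is_derive1_ln u0; apply: is_derive_eq.
  by rewrite sub0r powR_inv1 ?ltW//; field; rewrite gt_eqF.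
have -> : (fun x => (a * (a - 1))^-1 * (x `^ a - 1 - a * (x - 1))) =
    (a * (a - 1))^-1 \*: (@powR R ^~ a - cst 1 - a \*: (id - cst 1)) :> (R -> R).
  by apply/funext.
have dpow := is_derive1_powR a u0; apply: is_derive_eq.
by rewrite /GRing.scale/=; field; rewrite a0 a1'.
Qed.

Lemma derive1_falpha a u : a < 1 -> 0 < u ->
  derive1 (falpha a) u = (a - 1)^-1 * (u `^ (a - 1) - 1).
Proof.
by move=> a1 u0; rewrite derive1E; have /@derive_val := is_derive_falpha a1 u0.
Qed.

Lemma le_powR_neg a u v : a <= 0 -> 0 < u -> u <= v -> v `^ a <= u `^ a.
Proof.
move=> a0 u0 uv; have v0 := lt_le_trans u0 uv.
rewrite -(opprK a) !(powRN _ (- a)) lef_pV2 ?posrE ?powR_gt0//.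
by apply: ge0_ler_powR; rewrite ?oppr_ge0 ?nnegrE ?(ltW u0) ?(ltW v0).
Qed.

Lemma falpha1 a : a < 1 -> falpha a 1 = 0.
Proof.
move=> a1; rewrite /falpha ln1 powR1 !subrr.
by case: eqP => _; rewrite ?subr0 // mulr0 subr0 mulr0.
Qed.

(** [falpha a] vanishes at 1 and its derivative at [c] has the sign of [c - 1]; the mean value
    theorem between [u] and 1 concludes on either side. *)
Lemma falpha_ge0 a u : a < 1 -> 0 < u -> 0 <= falpha a u.
Proof.
move=> a1 u0.
have mvt (x y : R) : 0 < x -> x <= y -> exists2 c, x <= c <= y &
    falpha a y - falpha a x = (a - 1)^-1 * (c `^ (a - 1) - 1) * (y - x).
  move=> x0 xy.
  have [] := @MVT_segment _ (falpha a) (fun c => (a - 1)^-1 * (c `^ (a - 1) - 1))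
     x y xy.
  - move=> c; rewrite in_itv/= => /andP[xc _]; apply: is_derive_falpha => //.
    exact: lt_trans xc.
  - apply: derivable_within_continuous => c; rewrite in_itv/= => /andP[xc _].
    by have [] := is_derive_falpha a1 (lt_le_trans x0 xc).
  - by move=> c; rewrite in_itv/= => cxy ->; exists c.
have a1' : (a - 1)^-1 < 0 by rewrite invr_lt0 subr_lt0.
have a1'' : a - 1 <= 0 by rewrite subr_le0 ltW.
have [u1|/ltW u1] := leP u 1.
  have [c /andP[uc c1]] := mvt u 1 u0 u1.
  rewrite falpha1// sub0r => /(congr1 -%R); rewrite opprK => ->.
  rewrite oppr_ge0 mulr_le0_ge0 ?subr_ge0// nmulr_rle0// subr_ge0.
  by have := le_powR_neg a1'' (lt_le_trans u0 uc) c1; rewrite powR1.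
have [c /andP[uc c1]] := mvt 1 u ltr01 u1.
rewrite falpha1// subr0 => ->.
rewrite mulr_ge0 ?subr_ge0// nmulr_rge0// subr_le0.
by have := le_powR_neg a1'' ltr01 uc; rewrite powR1.
Qed.

Lemma phiM a u v : 0 < u -> 0 < v -> phi a (u * v) = phi a u + u `^ a * phi a v.
Proof.
move=> u0 v0; rewrite /phi; case: eqP => [->|/eqP a0].
  by rewrite lnM ?posrE// powRr0 mul1r opprD.
by rewrite powRM ?ltW//; ring.
Qed.

Lemma phi1 a : phi a 1 = 0.
Proof. by rewrite /phi ln1 powR1 subrr oppr0 mulr0; case: ifP. Qed.

(** Nonnegativity of [falpha a] with the linear part moved to the other side; the bound is the
    tangent to [phi a] at 1. *)
Lemma phi_ge a h : a < 1 -> 0 < h -> (h - 1) / (a - 1) <= phi a h.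
Proof.
move=> a1 h0; have := falpha_ge0 a1 h0; rewrite falphaE// -(opprB a 1) invrN mulrN.
by rewrite subr_ge0.
Qed.

Lemma phiV a h : 0 < h -> phi a h = - (h `^ a * phi a h^-1).
Proof.
move=> h0; apply/eqP; rewrite -addr_eq0 -phiM ?invr_gt0// divff ?lt0r_neq0//.
by rewrite phi1.
Qed.

Lemma phi_nincr a : a < 1 -> {in Num.pos &, {homo phi a : u v /~ u <= v}}.
Proof.
move=> a1 u v; rewrite !posrE => u0 v0 uv.
rewrite -[in leRHS](mulfVK (lt0r_neq0 u0) v) mulrC phiM ?divr_gt0//.
rewrite lerDl mulr_ge0 ?powR_ge0//; apply: le_trans (phi_ge a1 _); last first.
  by rewrite divr_gt0.
by rewrite mulr_le0 ?invr_le0 ?subr_le0 ?ler_pdivrMr ?mul1r// ltW.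
Qed.

(** [phi a h] and [h - 1] have opposite signs, so raising the exponent of [h] from [1 - a] to [s]
    can only lower the product. At exponent [1 - a] the product equals [- (h * phi a h^-1)] by
    [phiV], and [phi_ge] at [h^-1] gives the bound. *)
Lemma powR_phi_le a s h : a < 1 -> 1 - a <= s -> 0 < h ->
  h `^ s * phi a h <= (h - 1) / (a - 1).
Proof.
move=> a1 as1 h0; apply: (@le_trans _ _ (h `^ (1 - a) * phi a h)).
  rewrite -subr_le0 -mulrBl.
  have [h1|/ltW h1] := leP h 1.
    rewrite mulr_le0_ge0 ?subr_le0//.
      by rewrite ger_powR// h0.
    by rewrite -(phi1 a) phi_nincr ?posrE.
  rewrite mulr_ge0_le0 ?subr_ge0//.
    by rewrite ler_powR.
  by rewrite -(phi1 a) phi_nincr ?posrE.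
rewrite phiV// mulrN mulrA -powRD; last by rewrite (lt0r_neq0 h0) implybT.
rewrite subrK powRr1 ?(ltW h0)// lerNl -mulNr.
have := phi_ge a1 (_ : 0 < h^-1); rewrite invr_gt0 => /(_ h0).
rewrite -(ler_pM2l h0) mulrA mulrBr divff ?gt_eqF// mulr1.
by rewrite opprB.
Qed.

(** The tangent bound at 1, applied to [h / m] and scaled by [phiM], becomes the tangent bound at
    [m]. *)
Lemma phi_tangent a m h : a < 1 -> 0 < m -> 0 < h ->
  phi a m + (a - 1)^-1 * m `^ (a - 1) * (h - m) <= phi a h.
Proof.
move=> a1 m0 h0.
rewrite -[in leRHS](mulfVK (lt0r_neq0 m0) h) [_ * m]mulrC phiM ?divr_gt0//.
rewrite lerD2l; have := phi_ge a1 (divr_gt0 h0 m0).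
rewrite -(ler_pM2l (powR_gt0 a m0)); apply: le_trans.
rewrite powRB ?(lt0r_neq0 m0) ?implybT// powRr1 ?(ltW m0)// le_eqVlt; apply/orP; left; apply/eqP.
by field; rewrite subr_eq0 lt_eqF// gt_eqF.
Qed.

(** Here [e] is a relative error on the base. By monotonicity the relative change of the power lies
    between the powers of [1 - e] and [1 + e], and these two also enclose 1. *)
Lemma powR_dist_le r x y e : 0 <= r -> 0 < x -> 0 < y -> 0 <= e -> e < 1 ->
  `|y - x| <= x * e ->
  `|y `^ r - x `^ r| <= x `^ r * ((1 + e) `^ r - (1 - e) `^ r).
Proof.
move=> r0 x0 y0 e0 e1; rewrite ler_distl => /andP[ylo yhi].
have lo : x `^ r * (1 - e) `^ r <= y `^ r.
  rewrite -powRM ?(ltW x0) ?subr_ge0 ?(ltW e1)//.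
  apply: ge0_ler_powR => //; rewrite ?nnegrE ?(ltW y0)//.
    by rewrite mulr_ge0 ?(ltW x0) ?subr_ge0 ?(ltW e1).
  by rewrite mulrBr mulr1.
have hi : y `^ r <= x `^ r * (1 + e) `^ r.
  rewrite -powRM ?(ltW x0) ?addr_ge0//.
  apply: ge0_ler_powR => //; rewrite ?nnegrE ?(ltW y0)//.
    by rewrite mulr_ge0 ?(ltW x0) ?addr_ge0.
  by rewrite mulrDr mulr1.
have p1 : 1 <= (1 + e) `^ r.
  rewrite -[leLHS](congr1 (@^~ r) (@powR1 R)).
  by apply: ge0_ler_powR => //; rewrite ?nnegrE ?addr_ge0// lerDl.
have p2 : (1 - e) `^ r <= 1.
  rewrite -[leRHS](congr1 (@^~ r) (@powR1 R)).
  by apply: ge0_ler_powR => //; rewrite ?nnegrE ?subr_ge0 ?(ltW e1)// gerBl.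
have xr0 : 0 <= x `^ r by exact: powR_ge0.
rewrite ler_norml; apply/andP; split.
  have := ler_wpM2l xr0 p1; lra.
have := ler_wpM2l xr0 p2; lra.
Qed.

Lemma measurable_phi a : measurable_fun [set: R] (phi a).
Proof.
rewrite /phi; case: eqP => _.
  by apply: measurableT_comp => //; exact: measurable_ln.
by apply: measurable_funM => //; apply: measurable_funB => //.
Qed.

Lemma continuous_powR_pos a u : 0 < u -> {for u, continuous (@powR R ^~ a)}.
Proof.
move=> u0; have [d _] := is_derive1_powR a u0.
by apply: differentiable_continuous; exact/derivable1_diffP.
Qed.

Lemma continuous_phi a u : 0 < u -> {for u, continuous (phi a)}.
Proof.
move=> u0; rewrite /phi; case: eqP => _.
  by apply: cvgN; exact: continuous_ln.
apply: cvgM; first exact: cvg_cst.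
by apply: cvgB; [exact: continuous_powR_pos|exact: cvg_cst].
Qed.

End real_functions.

(** * Compact metric spaces, densities and dominated integrals *)

Lemma compact_finite_net (R : realType) (T : pseudoMetricType R) (e : R) :
  compact [set: T] -> 0 < e ->
  exists s : seq T, forall t, exists2 x, x \in s & ball x e t.
Proof.
move=> cT e0; apply: contrapT => nos.
(* the complements of finite unions of balls generate a filter; if no finite
   net existed it would be proper, but it has no cluster point *)
pose F : set_system T := [set A | exists s : seq T,
  forall t, (forall x, x \in s -> ~ ball x e t) -> A t].
have FF : ProperFilter F.
  split.
    move=> [s sF]; apply: nos; exists s => t; apply: contrapT => nt.
    by apply: (sF t) => x xs xt; apply: nt; exists x.
  split.
  - by exists [::].
  - move=> A B [s sA] [r rB]; exists (s ++ r) => t h; split.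
      by apply: sA => x xs; apply: h; rewrite mem_cat xs.
    by apply: rB => x xr; apply: h; rewrite mem_cat xr orbT.
  - by move=> A B AB [s sA]; exists s => t /sA /AB.
have [p [_ pF]] := cT F FF (filterT : F setT).
have Fp : F (~` ball p e).
  by exists [:: p] => t; apply; rewrite mem_head.
by have [q []] := pF _ _ Fp (nbhsx_ballx p e e0).
Qed.

Lemma compact_dense_seq (R : realType) (T : pseudoMetricType R) (t0 : T) :
  compact [set: T] ->
  exists D : nat -> T, forall t e, 0 < e -> exists n, ball (D n) e t.
Proof.
move=> cT.
have /choice[s sP] : forall n, exists s : seq T,
    forall t, exists2 x, x \in s & ball x n.+1%:R^-1 t.
  by move=> n; apply: compact_finite_net; rewrite ?invr_gt0.
(* All the nets are listed in one sequence by decoding [m] as a pair, the net and the position in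
   it. [t0] fills the codes that decode to nothing and the positions past the end of a net. *)
pose D (m : nat) := if @unpickle (nat * nat)%type m is Some (n, i)
  then nth t0 (s n) i else t0.
exists D => t e e0; have [n ne] : exists n, n.+1%:R^-1 < e.
  have [n] := @ltr_add_invr R 0 e e0; rewrite add0r; by exists n.
have [x xs xt] := sP n t; exists (pickle (n, index x (s n))).
by rewrite /D pickleK nth_index//; exact: le_ball (ltW ne) _ xt.
Qed.

(** The supremum may run over an uncountable set; continuity in [t] makes it equal to the supremum
    along a dense sequence, which is measurable. *)
Lemma measurable_ereal_sup_continuous (d : measure_display) (R : realType)
    (T : pseudoMetricType R) (Y : measurableType d) (F : T -> Y -> R) :
  compact [set: T] -> (forall y, continuous (F ^~ y)) ->
  (forall t, measurable_fun [set: Y] (F t)) ->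
  measurable_fun [set: Y] (fun y => ereal_sup [set (F t y)%:E | t in [set: T]]).
Proof.
move=> cT cF mF.
have [t0|T0] := pselect (exists t : T, True); last first.
  rewrite (_ : (fun _ => _) = cst -oo%E) //; apply/funext => y.
  rewrite (_ : [set _ | _ in _] = set0) ?ereal_sup0//.
  by apply/seteqP; split => // x [t]; exfalso; apply: T0; exists t.
have {t0}[t0 _] := t0.
have [D DP] := compact_dense_seq t0 cT.
rewrite (_ : (fun _ => _) = (fun y => esups (fun n => (F (D n) y)%:E) 0%N)).
  by apply: measurable_fun_esups => n; apply: measurableT_comp.
apply/funext => y; apply/eqP; rewrite eq_le; apply/andP; split; last first.
  apply: le_ereal_sup => _ [n _ <-]; by exists (D n).
apply: ge_ereal_sup => _ [t _ <-]; apply/lee_addgt0Pr => e e0.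
have /cvgrPdist_lt/(_ e e0)/nbhs_ballP[r /= r0 tr] := cF y t.
have [n Dn] := DP t r r0.
apply: (@le_trans _ _ ((F (D n) y)%:E + e%:E)%E).
  rewrite -EFinD lee_fin -lerBlDl.
  by rewrite (le_trans (ler_norm _))// ltW// tr//; exact: ball_sym.
rewrite leeD2r//; apply: ereal_sup_ubound; exists n => //.
Qed.

Lemma is_borel_continuous_measurable (d : measure_display) (R : realType)
    (T : measurableMetricType d R) (f : T -> R) :
  is_borel T -> continuous f -> measurable_fun [set: T] f.
Proof.
move=> bT /continuousP cf; apply: (measurability _ (RGenOpens.measurableE R)).
move=> _ [_ [a [b ->] <-]]; rewrite setTI bT.
by apply: sub_sigma_algebra; apply/cf/interval_open.
Qed.

(** Reduces continuity to sequences, the form in which dominated convergence delivers it. If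
    continuity fails at [t], points within [n.+1%:R^-1] of [t] have values at distance at least [e]
    from [f t]. *)
Lemma seq_continuous (R : realType) (T : metricType R) (f : T -> R) :
  (forall (u : nat -> T) t, u n @[n --> \oo] --> t ->
    f (u n) @[n --> \oo] --> f t) -> continuous f.
Proof.
move=> fu t; apply: contrapT => nf.
have [e e0 He] : exists2 e : R, 0 < e & forall n : nat, exists x,
    ball t n.+1%:R^-1 x /\ e <= `|f t - f x|.
  apply: contrapT => h; apply: nf; apply/cvgrPdist_lt => e e0.
  apply: contrapT => ht; apply: h; exists e => // n; apply: contrapT => hn.
  apply: ht; apply/nbhs_ballP; exists n.+1%:R^-1 => /=; first by rewrite invr_gt0.
  move=> x tx /=; rewrite ltNge; apply/negP => ex; apply: hn; by exists x.
have /choice[u uP] := He.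
have /fu /cvgrPdist_lt/(_ e e0)[N _ /(_ N (leqnn N))/=] : u n @[n --> \oo] --> t.
  apply/cvg_ballP => r r0; near=> n.
  apply: le_ball (uP n).1; apply/ltW; near: n.
  exact: (near_infty_natSinv_lt (PosNum r0)).
by rewrite ltNge (uP N).2.
Unshelve. all: by end_near. Qed.

(** * Probability measures given by a density *)

Section density_measure.
Context (d : measure_display) (R : realType) (T : measurableType d).
Variables (mu : probability T R) (h : T -> R).
Hypotheses (mh : measurable_fun [set: T] h) (h0 : forall t, 0 <= h t).
Hypothesis h1 : (\int[mu]_t (h t)%:E = 1)%E.

Let m (A : set T) : \bar R := (\int[mu]_(t in A) (h t)%:E)%E.

Let m0 : m set0 = 0%E. Proof. by rewrite /m integral_set0. Qed.

Let m_ge0 A : (0 <= m A)%E.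
Proof. by apply: integral_ge0 => t _; rewrite lee_fin. Qed.

Let m_sigma_additive : semi_sigma_additive m.
Proof.
move=> F mF tF mUF; rewrite /m; apply: cvg_toP.
  apply: ereal_nondecreasing_is_cvgn => i j ij.
  by apply: lee_sum_nneg_natr => // k _ _; exact: m_ge0.
rewrite ge0_integral_bigcup//.
  by apply/measurable_EFinP; exact: measurable_funTS.
by move=> t _; rewrite lee_fin.
Qed.

HB.instance Definition _ := isMeasure.Build _ _ _ m m0 m_ge0 m_sigma_additive.
HB.instance Definition _ := @Measure_isProbability.Build _ _ R m h1.

Lemma density_probability : exists nu : probability T R,
  forall A, measurable A -> nu A = (\int[mu]_(t in A) (h t)%:E)%E.
Proof. by exists m. Qed.

End density_measure.

(** * Bounded and dominated integrands *)

Section integration.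
Context (d : measure_display) (R : realType) (T : measurableType d).

Lemma bounded_integrable (mu : probability T R) (f : T -> R) (M : R) :
  measurable_fun [set: T] f -> (forall t, `|f t| <= M) ->
  mu.-integrable [set: T] (EFin \o f).
Proof.
move=> mf fM; have muT : (mu [set: T] < +oo)%E.
  by rewrite -ge0_fin_numE// fin_num_measure.
apply: measurable_bounded_integrable => //.
by exists M; split; [exact: num_real|move=> x Mx t _; exact: le_trans (ltW Mx)].
Qed.

Lemma integral_probability_cst (mu : probability T R) (r : R) :
  (\int[mu]_t r%:E = r%:E)%E.
Proof.
rewrite integral_cst//; transitivity (r%:E * 1)%E; last by rewrite mule1.
congr (_ * _)%E; exact: (probability_setT mu).
Qed.

Lemma Rintegral_probability_cst (mu : probability T R) (r : R) :
  \int[mu]_t r = r.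
Proof. by rewrite /Rintegral integral_probability_cst. Qed.

(** [h] agrees almost everywhere with the Radon-Nikodym derivative, since both have the same
    integral over every measurable set; the change of variables for that derivative then transfers
    to [h]. *)
Lemma Rintegral_density (mu nu : probability T R) (h f : T -> R) (M : R) :
  measurable_fun [set: T] h -> (forall t, 0 <= h t) ->
  (forall A, measurable A -> nu A = (\int[mu]_(t in A) (h t)%:E)%E) ->
  measurable_fun [set: T] f -> (forall t, `|f t| <= M) ->
  \int[nu]_t f t = \int[mu]_t (f t * h t).
Proof.
move=> mh h0 nuE mf fM.
have numu : nu `<< mu.
  apply/null_content_dominatesP => A mA A0; rewrite nuE//.
  apply: null_set_integral => //.
  apply/measurable_EFinP; exact: measurable_funTS.
have ih : mu.-integrable [set: T] (EFin \o h).
  apply/integrableP; split; first exact/measurable_EFinP.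
  under eq_integral do rewrite /= ger0_norm//.
  by rewrite -nuE// (probability_setT nu) ltry.
have inuf := @bounded_integrable nu f M mf fM.
rewrite /Rintegral; congr fine; rewrite -(Radon_Nikodym_change_of_variables numu)//.
apply: ae_eq_integral => //.
- by apply: emeasurable_funM; [exact/measurable_EFinP|].
- by apply/measurable_EFinP; exact: measurable_funM.
- rewrite (_ : (fun t => (f t * h t)%:E) = (EFin \o f) \* (EFin \o h))%E//.
  apply: ae_eqe_mul2l; apply: integral_ae_eq; [by []|exact: Radon_Nikodym_integrable| |].
    exact/measurable_EFinP.
  by move=> A _ mA; rewrite -Radon_Nikodym_integral//= nuE.
Qed.

Lemma Rintegral_dominated_cvg (mu : {measure set T -> \bar R})
    (f_ : nat -> T -> R) (f g : T -> R) :
  (forall n, measurable_fun [set: T] (f_ n)) -> measurable_fun [set: T] f ->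
  (forall t, f_ n t @[n --> \oo] --> f t) ->
  mu.-integrable [set: T] (EFin \o g) -> (forall n t, `|f_ n t| <= g t) ->
  \int[mu]_t f_ n t @[n --> \oo] --> \int[mu]_t f t.
Proof.
move=> mf_ mf f_f ig f_g.
have [] := @dominated_convergence _ _ _ mu _ measurableT
  (fun n t => (f_ n t)%:E) (EFin \o f) (EFin \o g).
- by move=> n; exact/measurable_EFinP.
- exact/measurable_EFinP.
- by apply: aeW => t _; apply: cvg_EFin; [exact: nearW|exact: f_f].
- exact: ig.
- by apply: aeW => t n _; rewrite lee_fin.
move=> intf _ cf; apply: fine_cvg; rewrite fineK//; exact: integrable_fin_num.
Qed.

Lemma dominated_integrable (mu : {measure set T -> \bar R}) (f g : T -> R) :
  measurable_fun [set: T] f -> mu.-integrable [set: T] (EFin \o g) ->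
  (forall t, `|f t| <= g t) -> mu.-integrable [set: T] (EFin \o f).
Proof.
move=> mf ig fg; apply: le_integrable ig => //; first exact/measurable_EFinP.
by move=> t _; rewrite /= lee_fin (le_trans (fg t))// ler_norm.
Qed.

End integration.

(** * Fubini under a bound that depends on the second variable only *)

Section fubini_bounded.
Context (d dY : measure_display) (R : realType) (T : measurableType d)
  (Y : measurableType dY).
Variables (mu : probability T R) (nu : {sigma_finite_measure set Y -> \bar R}).
Variables (f : T * Y -> R) (H : Y -> R).
Hypotheses (mf : measurable_fun [set: T * Y] f)
  (iH : nu.-integrable [set: Y] (EFin \o H)) (fH : forall t y, `|f (t, y)| <= H y).

Let mf1 t : measurable_fun [set: Y] (fun y => f (t, y)).
Proof. exact: measurableT_comp. Qed.

Let mf2 y : measurable_fun [set: T] (fun t => f (t, y)).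
Proof. exact: measurableT_comp. Qed.

Lemma dominated_integrable1 t :
  nu.-integrable [set: Y] (fun y => (f (t, y))%:E).
Proof. by apply: (@dominated_integrable _ _ _ _ (fun y => f (t, y)) H). Qed.

Lemma dominated_integrable2 y :
  mu.-integrable [set: T] (fun t => (f (t, y))%:E).
Proof. by apply: (@bounded_integrable _ _ _ _ (fun t => f (t, y)) (H y)). Qed.

Lemma dominated_Rintegral2_le y : `|\int[mu]_t f (t, y)| <= H y.
Proof.
apply: le_trans (le_normr_Rintegral _ _) _ => //; first exact: dominated_integrable2.
rewrite -[leRHS](Rintegral_probability_cst mu).
apply: le_Rintegral => //.
- exact: integrable_norm (dominated_integrable2 y).
- exact: (@bounded_integrable _ _ _ _ _ `|H y|).
Qed.

(** Since [H] does not depend on [t] and [mu] has mass one, integrating the norm of [f] over [T]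
    first leaves at most the integral of [H]. *)
Let intf : (mu \x nu)%E.-integrable [set: T * Y] (EFin \o f).
Proof.
apply/integrable21ltyP; first exact/measurable_EFinP.
apply: (@le_lt_trans _ _ (\int[nu]_y (H y)%:E)%E); last first.
  exact: integrable_lty.
have H0 y : 0 <= H y by exact: le_trans (dominated_Rintegral2_le y).
apply: ge0_le_integral => //=.
- by move=> y _; exact: integral_ge0.
- apply: (measurable_fun_fubini_tonelli_G (fun z => `|(f z)%:E|)%E) => //.
  by apply: measurableT_comp => //; exact/measurable_EFinP.
- exact: measurable_int iH.
- move=> y _; apply: (@le_trans _ _ (\int[mu]_t (H y)%:E)%E).
    apply: ge0_le_integral => //=.
      by apply/measurable_EFinP; apply: measurableT_comp => //; exact: mf2.
    by move=> t _; rewrite lee_fin.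
  by rewrite integral_probability_cst.
Qed.

Lemma dominated_integrable_Rintegral2 :
  nu.-integrable [set: Y] (fun y => (\int[mu]_t f (t, y))%:E).
Proof.
apply: (@dominated_integrable _ _ _ _ _ H) => //.
  have := measurable_fubini_G intf.
  rewrite (_ : fubini_G _ _ = fun y => (\int[mu]_t f (t, y))%:E).
    by move/measurable_EFinP.
  apply/funext => y; rewrite /fubini_G /= fineK//.
  exact: integrable_fin_num (dominated_integrable2 y).
exact: dominated_Rintegral2_le.
Qed.

Lemma dominated_Rintegral_fubini :
  \int[mu]_t \int[nu]_y f (t, y) = \int[nu]_y \int[mu]_t f (t, y).
Proof.
rewrite /Rintegral; congr fine.
under eq_integral => t _.
  rewrite fineK; last exact: integrable_fin_num (dominated_integrable1 t).
  over.
under [RHS]eq_integral => y _.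
  rewrite fineK; last exact: integrable_fin_num (dominated_integrable2 y).
  over.
exact: (Fubini intf).
Qed.

End fubini_bounded.

(** * Extrema of continuous functions on a compact space *)

Section compact_sup.
Context (R : realType) (T : topologicalType).
Hypothesis cT : compact [set: T].
Variable t0 : T.
Implicit Types f : T -> R.

Lemma compact_argmax f : continuous f -> exists t, forall x, f x <= f t.
Proof.
move=> cf; have [||t _ tP] := @compact_EVT_max T R f [set: T] _ cT.
- by exists t0.
- exact: continuous_subspaceT.
by exists t => x; apply: tP; rewrite inE.
Qed.

Lemma compact_argmin f : continuous f -> exists t, forall x, f t <= f x.
Proof.
move=> cf; have [||t _ tP] := @compact_EVT_min T R f [set: T] _ cT.
- by exists t0.
- exact: continuous_subspaceT.
by exists t => x; apply: tP; rewrite inE.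
Qed.

Lemma compact_norm_bounded f : continuous f -> exists M, forall x, `|f x| <= M.
Proof.
move=> cf; have [t tP] : exists t, forall x, `|f x| <= `|f t|.
  apply: (@compact_argmax (fun x => `|f x|)) => x.
  exact: (cvg_norm (cf x)).
by exists `|f t|.
Qed.

(** Real counterpart of the extended suprema in the integrability hypotheses. For continuous [f]
    nothing is lost by [fine], because the supremum is attained. *)
Definition supT f : R := fine (ereal_sup [set (f t)%:E | t in [set: T]]).

Lemma EFin_supT f : continuous f ->
  ereal_sup [set (f t)%:E | t in [set: T]] = (supT f)%:E.
Proof.
move=> /compact_argmax[t tP]; rewrite /supT (_ : ereal_sup _ = (f t)%:E)//.
apply/eqP; rewrite eq_le; apply/andP; split.
  by apply: ge_ereal_sup => _ [x _ <-]; rewrite lee_fin.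
by apply: ereal_sup_ubound; exists t.
Qed.

Lemma le_supT f t : continuous f -> f t <= supT f.
Proof.
by move=> cf; rewrite -lee_fin -EFin_supT//; apply: ereal_sup_ubound; exists t.
Qed.

End compact_sup.

Lemma measurable_supT (d : measure_display) (R : realType)
    (T : pseudoMetricType R) (Y : measurableType d) (F : T -> Y -> R) :
  compact [set: T] -> (forall y, continuous (F ^~ y)) ->
  (forall t, measurable_fun [set: Y] (F t)) ->
  measurable_fun [set: Y] (fun y => supT (F ^~ y)).
Proof.
move=> cT cF mF; apply: measurableT_comp; first exact: fine_measurable.
exact: measurable_ereal_sup_continuous.
Qed.

(** * The power descent *)

Section power_descent_theory.
Context (R : realType) (d dY : measure_display)
    (T : measurableMetricType d R) (Y : measurableType dY)
    (nu : {sigma_finite_measure set Y -> \bar R})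
    (k : T -> Y -> R) (p : Y -> R) (alpha : R).
Hypothesis hk : kernel_density nu k.
Hypothesis hp : measurable_fun [set: Y] p.
Hypothesis hk0 : forall (t : T) (y : Y), 0 < k t y.
Hypothesis hp0 : forall y : Y, 0 < p y.
Hypothesis hpint : (\int[nu]_y (p y)%:E < +oo)%E.
Hypothesis halpha : alpha < 1.
Hypothesis hcompact : compact [set: T].
Hypothesis hborel : is_borel T.
Hypothesis hcont : forall y : Y, continuous (fun t : T => k t y).
Hypothesis hsup : (\int[nu]_y (ereal_sup [set (k t y)%:E | t in [set: T]] *
      ereal_sup [set ((k t y / p y) `^ (alpha - 1))%:E | t in [set: T]])
      < +oo)%E.
Hypothesis hlog : alpha = 0 ->
      (\int[nu]_y (ereal_sup [set `|ln (k t y / p y)|%:E | t in [set: T]] *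
        (p y)%:E) < +oo)%E.
Variable t0 : T.
Implicit Types mu zeta : probability T R.

Local Notation mix mu := (mixture k mu).
(** The integrand of [hsup] in real form; it dominates [k t y * slope mu y] for all [mu] and [t] at
    once. *)
Local Notation Hsup := (fun y =>
  supT (k^~ y) * supT (fun t => (k t y / p y) `^ (alpha - 1))).

(** The nonconstant part of the derivative of [falpha alpha] at the mixture ratio, up to the factor
    [(alpha - 1)^-1]. Accordingly [(alpha - 1) * gradb + 1] is [score]. *)
Definition slope mu y := (mix mu y / p y) `^ (alpha - 1).
Definition score mu t := \int[nu]_y (k t y * slope mu y).

Lemma measurable_k : measurable_fun [set: T * Y] (fun z => k z.1 z.2).
Proof. by have [] := hk. Qed.

Lemma measurable_k1 t : measurable_fun [set: Y] (k t).
Proof.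
exact: (measurableT_comp measurable_k (pair1_measurable t)).
Qed.

Lemma measurable_k2 y : measurable_fun [set: T] (k^~ y).
Proof.
exact: (measurableT_comp measurable_k (pair2_measurable y)).
Qed.

Lemma integral_k t : (\int[nu]_y (k t y)%:E = 1)%E.
Proof. by have [_ [K KE]] := hk; rewrite -KE// prob_kernel. Qed.

Lemma integrable_k1 t : nu.-integrable [set: Y] (EFin \o k t).
Proof.
apply/integrableP; split; first exact/measurable_EFinP/measurable_k1.
under eq_integral do rewrite /= ger0_norm ?ltW//.
by rewrite integral_k ltry.
Qed.

Lemma integrable_p : nu.-integrable [set: Y] (EFin \o p).
Proof.
apply/integrableP; split; first exact/measurable_EFinP.
by under eq_integral do rewrite /= ger0_norm ?ltW//.
Qed.

Lemma integrable_k2 mu y : mu.-integrable [set: T] (fun t => (k t y)%:E).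
Proof.
have [M MP] := compact_norm_bounded hcompact t0 (@hcont y).
exact: (@bounded_integrable _ _ _ mu (k^~ y) M (measurable_k2 y) MP).
Qed.

(** * Pointwise bounds on mixtures and slopes *)

Lemma continuous_ratio y (F : R -> R) :
  (forall u, 0 < u -> {for u, continuous F}) ->
  continuous (fun t => F (k t y / p y)).
Proof.
move=> cF t; apply: (@continuous_comp _ _ _ (fun t => k t y / p y) F).
  by apply: cvgM; [exact: hcont|exact: cvg_cst].
by apply: cF; rewrite divr_gt0.
Qed.

Lemma continuous_ratio_powR y :
  continuous (fun t => (k t y / p y) `^ (alpha - 1)).
Proof.
apply: (@continuous_ratio y (fun u => u `^ (alpha - 1))) => u.
exact: continuous_powR_pos.
Qed.

Lemma continuous_ratio_ln y : continuous (fun t => `|ln (k t y / p y)|).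
Proof.
apply: (@continuous_ratio y (fun u => `|ln u|)) => u u0.
by apply: cvg_norm; exact: continuous_ln.
Qed.

(** A mean lies between the minimum and the maximum of [k^~ y]. The bounds are given as values at
    points of [T], so that they pass through any monotone function of the ratio and remain below a
    supremum over [T]. *)
Lemma mixture_bounds mu y : exists t1 t2,
  k t1 y <= mix mu y /\ mix mu y <= k t2 y.
Proof.
have [t1 t1P] := compact_argmin hcompact t0 (@hcont y).
have [t2 t2P] := compact_argmax hcompact t0 (@hcont y).
have ic c : mu.-integrable [set: T] (EFin \o cst c).
  exact: (@bounded_integrable _ _ _ mu (cst c) `|c|).
have ik := integrable_k2 mu y.
exists t1, t2; split.
  rewrite -[leLHS](Rintegral_probability_cst mu).
  by apply: le_Rintegral => //; exact: ic.
rewrite -[leRHS](Rintegral_probability_cst mu).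
by apply: le_Rintegral => //; exact: ic.
Qed.

Lemma mixture_gt0 mu y : 0 < mix mu y.
Proof. by have [t1 [_ [h _]]] := mixture_bounds mu y; exact: lt_le_trans h. Qed.

Lemma mixture_le mu y : mix mu y <= supT (k^~ y).
Proof.
have [_ [t2 [_ h]]] := mixture_bounds mu y; apply: (le_trans h).
exact: (le_supT hcompact t0 t2 (@hcont y)).
Qed.

Lemma slope_gt0 mu y : 0 < slope mu y.
Proof. by rewrite powR_gt0// divr_gt0// mixture_gt0. Qed.

(** The exponent [alpha - 1] is negative and reverses the order, so the lower bound on the mixture
    is the one that matters. *)
Lemma slope_le mu y :
  slope mu y <= supT (fun t => (k t y / p y) `^ (alpha - 1)).
Proof.
have [t1 [_ [h _]]] := mixture_bounds mu y.
apply: (le_trans _ (le_supT hcompact t0 t1 (@continuous_ratio_powR y))).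
apply: le_powR_neg; rewrite ?subr_le0 ?(ltW halpha)// ?divr_gt0//.
by rewrite ler_pM2r ?invr_gt0.
Qed.

Lemma ln_mixture_le mu y :
  `|ln (mix mu y / p y)| <= supT (fun t => `|ln (k t y / p y)|).
Proof.
have [t1 [t2 [h1 h2]]] := mixture_bounds mu y.
have m0 := mixture_gt0 mu y.
(* The sign of the logarithm selects the extremum: the upper bound on the mixture when it is
   nonnegative, the lower one otherwise. *)
have [u1|u1] := leP 0 (ln (mix mu y / p y)).
  apply: (le_trans _ (le_supT hcompact t0 t2 (@continuous_ratio_ln y))).
  rewrite ger0_norm// (le_trans _ (ler_norm _))// ler_ln ?posrE ?divr_gt0//.
  by rewrite ler_pM2r ?invr_gt0.
apply: (le_trans _ (le_supT hcompact t0 t1 (@continuous_ratio_ln y))).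
rewrite ltr0_norm// -normrN (le_trans _ (ler_norm _))// lerN2.
by rewrite ler_ln ?posrE ?divr_gt0// ler_pM2r ?invr_gt0.
Qed.

Lemma measurable_mixture mu : measurable_fun [set: Y] (mix mu).
Proof.
apply: measurableT_comp; first exact: fine_measurable.
apply: (measurable_fun_fubini_tonelli_G (fun z : T * Y => (k z.1 z.2)%:E)).
  by apply/measurable_EFinP; exact: measurable_k.
by move=> z; rewrite lee_fin ltW.
Qed.

Lemma measurable_pV : measurable_fun [set: Y] (fun y => (p y)^-1).
Proof.
rewrite (_ : (fun y => _) = (fun y => p y `^ (-1))).
  exact: (measurableT_comp (measurable_powR _)).
by apply/funext => y; rewrite powR_inv1// ltW.
Qed.

Lemma measurable_ratio mu : measurable_fun [set: Y] (fun y => mix mu y / p y).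
Proof.
apply: measurable_funM; first exact: measurable_mixture.
exact: measurable_pV.
Qed.

Lemma measurable_slope mu : measurable_fun [set: Y] (slope mu).
Proof.
apply: (measurableT_comp (measurable_powR _)); exact: measurable_ratio.
Qed.

Lemma integral_mixture mu : (\int[nu]_y (mix mu y)%:E = 1)%E.
Proof.
under eq_integral.
  move=> y _; rewrite fineK; last exact: integrable_fin_num (integrable_k2 mu y).
  over.
rewrite -(fubini_tonelli (fun z : T * Y => (k z.1 z.2)%:E))//=.
- by under eq_integral do rewrite integral_k; exact: integral_probability_cst.
- by apply/measurable_EFinP; exact: measurable_k.
- by move=> z; rewrite lee_fin ltW.
Qed.

Lemma integrable_mixture mu : nu.-integrable [set: Y] (EFin \o mix mu).
Proof.
apply/integrableP; split; first exact/measurable_EFinP/measurable_mixture.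
under eq_integral do rewrite /= ger0_norm ?ltW ?mixture_gt0//.
by rewrite integral_mixture ltry.
Qed.

Lemma Hsup_ge0 y : 0 <= Hsup y.
Proof.
apply: mulr_ge0.
  exact: le_trans (ltW (hk0 t0 y)) (le_supT hcompact t0 t0 (@hcont y)).
exact: le_trans (powR_ge0 _ _) (le_supT hcompact t0 t0 (@continuous_ratio_powR y)).
Qed.

Lemma integrable_Hsup : nu.-integrable [set: Y] (EFin \o Hsup).
Proof.
apply/integrableP; split.
  apply/measurable_EFinP/measurable_funM.
    by apply: measurable_supT => // t; exact: measurable_k1.
  apply: (@measurable_supT _ _ _ _ (fun t y => (k t y / p y) `^ (alpha - 1))) => //.
    exact: continuous_ratio_powR.
  move=> t; apply: (measurableT_comp (measurable_powR _)).
  by apply: measurable_funM; [exact: measurable_k1|exact: measurable_pV].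
apply: le_lt_trans hsup; rewrite le_eqVlt; apply/orP; left; apply/eqP.
apply: eq_integral => y _ /=; rewrite ger0_norm ?Hsup_ge0//.
rewrite EFinM -!EFin_supT//; exact: continuous_ratio_powR.
Qed.


(** * Integrability, positivity and continuity of the score *)

Lemma weight_le mu t y : `|k t y * slope mu y| <= Hsup y.
Proof.
rewrite ger0_norm; last by rewrite mulr_ge0 ?(ltW (hk0 _ _)) ?(ltW (slope_gt0 _ _)).
by rewrite ler_pM ?(ltW (hk0 _ _)) ?(ltW (slope_gt0 _ _)) ?slope_le//
  (le_supT hcompact t0 t (@hcont y)).
Qed.

Lemma measurable_weight mu :
  measurable_fun [set: T * Y] (fun z => k z.1 z.2 * slope mu z.2).
Proof.
apply: measurable_funM; first exact: measurable_k.
exact: (measurableT_comp (measurable_slope mu) measurable_snd).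
Qed.

Lemma integrable_weight mu t :
  nu.-integrable [set: Y] (EFin \o (fun y => k t y * slope mu y)).
Proof.
exact: (@dominated_integrable1 _ _ _ _ _ nu _ _ (measurable_weight mu)
  integrable_Hsup (weight_le mu)).
Qed.

(** If the integral were zero, a strictly positive weight would vanish almost everywhere. Every
    function would then do so too, including [k t], whose integral is 1. *)
Lemma score_gt0 mu t : 0 < score mu t.
Proof.
have w0 y : 0 < k t y * slope mu y by rewrite mulr_gt0// slope_gt0.
have iw := integrable_weight mu t.
rewrite lt_neqAle Rintegral_ge0 ?andbT; last by move=> y _; exact: ltW.
apply/negP => /eqP/esym s0.
have : (\int[nu]_y `|(k t y * slope mu y)%R%:E| = 0)%E.
  under eq_integral do rewrite /= ger0_norm ?(ltW (w0 _))//.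
  by rewrite -[LHS]fineK ?[fine _]s0//; exact: integrable_fin_num iw.
move/(ae_eq_integral_abs _ measurableT (measurable_int _ iw)) => w_ae0.
have : ae_eq nu [set: Y] (EFin \o k t) (cst 0%E).
  by apply: filterS w_ae0 => y /(_ I) /eqP; rewrite /= eqe gt_eqF.
move/ae_eq_integral => /(_ measurableT) k0.
have : (1 = 0 :> \bar R)%E.
  rewrite -(integral_k t) [LHS]k0 ?integral0//.
  exact: measurable_int (integrable_k1 t).
by move/eqP; rewrite onee_eq0.
Qed.

Lemma score_continuous mu : continuous (score mu).
Proof.
apply: seq_continuous => u t ut.
apply: (@Rintegral_dominated_cvg _ _ _ _ _ _ Hsup).
- by move=> n; apply/measurable_EFinP; exact: measurable_int (integrable_weight mu _).
- by apply/measurable_EFinP; exact: measurable_int (integrable_weight mu _).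
- move=> y; apply: cvgM; last exact: cvg_cst.
  exact: (@cvg_comp _ _ _ u (k^~ y) _ _ _ ut (@hcont y t)).
- exact: integrable_Hsup.
- by move=> n y; exact: weight_le.
Qed.

Lemma score_lb mu : exists2 m, 0 < m & forall t, m <= score mu t.
Proof.
have [t tP] := compact_argmin hcompact t0 (@score_continuous mu).
by exists (score mu t) => //; exact: score_gt0.
Qed.

Lemma gradbE mu t : gradb nu k p alpha mu t = (alpha - 1)^-1 * (score mu t - 1).
Proof.
rewrite /gradb.
under eq_Rintegral.
  move=> y _; rewrite derive1_falpha ?divr_gt0 ?mixture_gt0//.
  rewrite mulrCA -/(slope mu y) mulrBr mulr1.
  over.
have ik := integrable_k1 t; have iw := integrable_weight mu t.
rewrite RintegralZl//; last exact: (integrableB measurableT iw ik).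
rewrite RintegralB//; congr (_ * (_ - _)).
by rewrite /Rintegral integral_k.
Qed.

(** Turns an integral over [T] against the score into one over [Y], where pointwise inequalities for
    [phi] can be integrated. It serves with [f] equal to [phi alpha (h t)] for the descent and to 1
    for the tangent inequality. *)
Lemma score_fubini zeta mu (f : T -> R) (M : R) :
  measurable_fun [set: T] f -> (forall t, `|f t| <= M) ->
  nu.-integrable [set: Y]
    (EFin \o (fun y => slope mu y * \int[zeta]_t (f t * k t y))) /\
  \int[zeta]_t (f t * score mu t) =
  \int[nu]_y (slope mu y * \int[zeta]_t (f t * k t y)).
Proof.
move=> mf fM.
pose F (z : T * Y) := f z.1 * (k z.1 z.2 * slope mu z.2).
have mF : measurable_fun [set: T * Y] F.
  apply: measurable_funM; last exact: measurable_weight.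
  exact: (measurableT_comp mf measurable_fst).
have iMH : nu.-integrable [set: Y] (EFin \o (fun y => M * Hsup y)).
  exact: (integrableZl measurableT M integrable_Hsup).
have FM t y : `|F (t, y)| <= M * Hsup y.
  by rewrite normrM ler_pM// weight_le.
have fk y : \int[zeta]_t F (t, y) = slope mu y * \int[zeta]_t (f t * k t y).
  rewrite -RintegralZl//; first by apply: eq_Rintegral => t _; rewrite /F/=; ring.
  apply: (@bounded_integrable _ _ _ _ _ (M * supT (k^~ y))).
    by apply: measurable_funM => //; exact: measurable_k2.
  move=> t; rewrite normrM ler_pM// ger0_norm ?(ltW (hk0 _ _))//.
  exact: (le_supT hcompact t0 t (@hcont y)).
split.
  have := @dominated_integrable_Rintegral2 _ _ _ _ _ zeta nu F _ mF iMH FM.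
  by apply: eq_integrable => // y _; rewrite /= fk.
transitivity (\int[zeta]_t \int[nu]_y F (t, y)).
  apply: eq_Rintegral => t _; rewrite -RintegralZl//; exact: integrable_weight.
rewrite (@dominated_Rintegral_fubini _ _ _ _ _ zeta nu F _ mF iMH FM).
by apply: eq_Rintegral => y _; rewrite fk.
Qed.

(** * The objective, its descent inequality and its tangent inequality *)

Lemma ratio_powR mu y :
  (mix mu y / p y) `^ alpha * p y = slope mu y * mix mu y.
Proof.
have u0 : 0 < mix mu y / p y by rewrite divr_gt0// mixture_gt0.
rewrite /slope powRB ?(lt0r_neq0 u0) ?implybT// powRr1 ?(ltW u0)//.
by field; rewrite !lt0r_neq0// mixture_gt0.
Qed.

(** The part of [Psi] that varies with [mu]: mixtures all have total mass one, so the linear part of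
    [falpha] contributes a constant. *)
Definition Phi mu := \int[nu]_y (phi alpha (mix mu y / p y) * p y).

(** The dominating function is independent of [mu], so it yields both the finiteness of [Phi] and
    its convergence along the iterates. It comes from [hlog] when [alpha = 0], and otherwise from
    [Hsup] and [p] through [ratio_powR]. *)
Lemma phi_mixture_dominated : exists2 B : Y -> R,
  nu.-integrable [set: Y] (EFin \o B) &
  forall mu y, `|phi alpha (mix mu y / p y) * p y| <= B y.
Proof.
rewrite /phi; case: eqP => [a0|_].
  exists (fun y => supT (fun t => `|ln (k t y / p y)|) * p y); last first.
    move=> mu y; rewrite normrM normrN (ger0_norm (ltW (hp0 y))).
    by rewrite ler_pM2r// ln_mixture_le.
  have L0 y : 0 <= supT (fun t => `|ln (k t y / p y)|).
    exact: le_trans _ (le_supT hcompact t0 t0 (@continuous_ratio_ln y)).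
  apply/integrableP; split.
    apply/measurable_EFinP/measurable_funM => //.
    apply: (@measurable_supT _ _ _ _ (fun t y => `|ln (k t y / p y)|)) => //.
      exact: continuous_ratio_ln.
    move=> t; apply: measurableT_comp => //.
    apply: (measurableT_comp (@measurable_ln R)).
    by apply: measurable_funM; [exact: measurable_k1|exact: measurable_pV].
  apply: le_lt_trans (hlog a0); rewrite le_eqVlt; apply/orP; left; apply/eqP.
  apply: eq_integral => y _ /=; rewrite ger0_norm ?mulr_ge0 ?(ltW (hp0 y))//.
  by rewrite EFinM -EFin_supT//; exact: continuous_ratio_ln.
exists (fun y => `|(alpha * (alpha - 1))^-1| * (Hsup y + p y)).
  exact: (integrableZl measurableT `|(alpha * (alpha - 1))^-1|
    (integrableD measurableT integrable_Hsup integrable_p)).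
move=> mu y; rewrite -mulrA normrM ler_wpM2l// mulrBl mul1r ratio_powR.
apply: le_trans (ler_normB _ _) _; rewrite (ger0_norm (ltW (hp0 y))) lerD2r.
rewrite ger0_norm; last by rewrite mulr_ge0// ltW ?slope_gt0 ?mixture_gt0.
rewrite mulrC ler_pM ?mixture_le ?slope_le//; rewrite ltW ?slope_gt0//.
exact: mixture_gt0.
Qed.

Lemma integrable_phi_mixture mu :
  nu.-integrable [set: Y] (EFin \o (fun y => phi alpha (mix mu y / p y) * p y)).
Proof.
have [B iB hB] := phi_mixture_dominated.
apply: (dominated_integrable _ iB) => //.
apply: measurable_funM => //.
exact: (measurableT_comp (@measurable_phi R alpha) (measurable_ratio mu)).
Qed.

Lemma PsiE mu : Psi nu k p alpha mu =
  (Phi mu + (1 - \int[nu]_y p y) / (1 - alpha))%:E.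
Proof.
have iphi := integrable_phi_mixture mu; have imix := integrable_mixture mu.
have idiff : nu.-integrable [set: Y] (EFin \o (fun y => mix mu y - p y)).
  exact: (integrableB measurableT imix integrable_p).
rewrite /Psi.
under eq_integral.
  move=> y _; rewrite falphaE//.
  rewrite (_ : _ * _ = phi alpha (mix mu y / p y) * p y +
     (1 - alpha)^-1 * (mix mu y - p y)); last first.
    by field; rewrite (lt0r_neq0 (hp0 y)) subr_eq0 gt_eqF.
  over.
have iz : nu.-integrable [set: Y]
    (EFin \o (fun y => (1 - alpha)^-1 * (mix mu y - p y))).
  exact: (integrableZl measurableT _ idiff).
rewrite -[LHS]fineK; last first.
  exact: integrable_fin_num (integrableD measurableT iphi iz).
congr EFin; rewrite -/(Rintegral _ _ _) RintegralD//; congr (_ + _).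
rewrite RintegralZl// RintegralB//; last exact: integrable_p.
by rewrite mulrC /Rintegral integral_mixture.
Qed.


Lemma continuous_integrable mu (f : T -> R) :
  continuous f -> mu.-integrable [set: T] (EFin \o f).
Proof.
move=> cf; have [M fM] := compact_norm_bounded hcompact t0 cf.
exact: (@bounded_integrable _ _ _ mu f M
  (is_borel_continuous_measurable hborel cf) fM).
Qed.

(* Jensen's inequality for the probability weights
   [k t y / mixture k mu y * mu(dt)]. *)
Lemma Phi_descent mu mu' (h : T -> R) :
  continuous h -> (forall t, 0 < h t) ->
  (forall A, measurable A -> mu' A = (\int[mu]_(t in A) (h t)%:E)%E) ->
  Phi mu' - Phi mu <= \int[mu]_t (phi alpha (h t) * score mu t).
Proof.
move=> ch h0 mu'E.
have mh := is_borel_continuous_measurable hborel ch.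
have cphi : continuous (fun t => phi alpha (h t)).
  move=> t; apply: (@continuous_comp _ _ _ h (phi alpha)); first exact: ch.
  exact: continuous_phi.
have [M phiM'] := compact_norm_bounded hcompact t0 cphi.
have mphi := is_borel_continuous_measurable hborel cphi.
have [iF ->] := @score_fubini mu mu _ M mphi phiM'.
have mix'E y : mix mu' y = \int[mu]_t (k t y * h t).
  have [K KP] := compact_norm_bounded hcompact t0 (@hcont y).
  apply: (@Rintegral_density _ _ _ mu mu' h (k^~ y) K) => //.
    by move=> t; exact: ltW.
  exact: measurable_k2.
rewrite /Phi -RintegralB//; [|exact: integrable_phi_mixture..].
apply: le_Rintegral => //.
  exact: (integrableB measurableT (integrable_phi_mixture mu')
    (integrable_phi_mixture mu)).
(* [m] is the mean of [h] under the weights of Jensen's inequality. By [phiM] the change of [phi] at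
   the ratio is a multiple of [phi alpha m]. *)
move=> y _; pose m := mix mu' y / mix mu y.
have mix0 := mixture_gt0 mu y; have m0 : 0 < m by rewrite divr_gt0// mixture_gt0.
have -> : mix mu' y / p y = (mix mu y / p y) * m.
  by rewrite /m; field; rewrite !lt0r_neq0.
rewrite (phiM _ _ m0) ?divr_gt0// mulrDl addrAC subrr add0r mulrAC ratio_powR -mulrA.
rewrite ler_pM2l ?slope_gt0//.
pose b := (alpha - 1)^-1 * m `^ (alpha - 1).
have ck : continuous (k^~ y) by exact: hcont.
have ckh : continuous (fun t => k t y * h t).
  by move=> t; apply: cvgM; [exact: ck|exact: ch].
have ctan : continuous (fun t => (phi alpha m - b * m) * k t y + b * (k t y * h t)).
  move=> t; apply: cvgD.
    by apply: cvgM; [exact: cvg_cst|exact: ck].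
  by apply: cvgM; [exact: cvg_cst|exact: ckh].
have cphik : continuous (fun t => phi alpha (h t) * k t y).
  by move=> t; apply: cvgM; [exact: cphi|exact: ck].
(* The tangent of [phi] at [m] is integrated against the weights; its linear term cancels because
   [m] is the mean of [h]. *)
have -> : mix mu y * phi alpha m =
    \int[mu]_t ((phi alpha m - b * m) * k t y + b * (k t y * h t)).
  have ik := continuous_integrable mu ck; have ikh := continuous_integrable mu ckh.
  rewrite RintegralD//; first last.
  - exact: (integrableZl measurableT b ikh).
  - exact: (integrableZl measurableT _ ik).
  rewrite !RintegralZl// -mix'E -/(mixture _ _ _) /m.
  by field; rewrite lt0r_neq0.
apply: le_Rintegral => //; [exact: continuous_integrable..|].
move=> t _; have := phi_tangent halpha m0 (h0 t); rewrite -/b.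
rewrite -(ler_pM2r (hk0 t y)); apply: le_trans.
by rewrite le_eqVlt; apply/orP; left; apply/eqP; ring.
Qed.

(** First-order convexity: [phi_tangent] is applied at each [y] with the ratio of [mu] as base
    point, where the derivative is [(alpha - 1)^-1 * slope mu y]. Fubini turns the linear term into
    integrals of the score. *)
Lemma Phi_tangent mu zeta : Phi mu + (alpha - 1)^-1 *
    (\int[zeta]_t score mu t - \int[mu]_t score mu t) <= Phi zeta.
Proof.
have fub xi : nu.-integrable [set: Y] (EFin \o (fun y => slope mu y * mix xi y)) /\
    \int[xi]_t score mu t = \int[nu]_y (slope mu y * mix xi y).
  have [//|t|] := @score_fubini xi mu (cst 1) 1; first by rewrite normr1.
  under eq_Rintegral do rewrite mul1r.
  have E y : \int[xi]_t (1 * k t y) = mix xi y.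
    by apply: eq_Rintegral => t _; rewrite mul1r.
  move=> H1 H2; split.
    by apply: eq_integrable H1 => // y _; rewrite /= E.
  by rewrite H2; apply: eq_Rintegral => y _; rewrite E.
have [iz ->] := fub zeta; have [im ->] := fub mu.
have iphi := integrable_phi_mixture.
have iB : nu.-integrable [set: Y]
    (EFin \o (fun y => slope mu y * mix zeta y - slope mu y * mix mu y)).
  exact: (integrableB measurableT iz im).
have iZ : nu.-integrable [set: Y] (EFin \o (fun y => (alpha - 1)^-1 *
    (slope mu y * mix zeta y - slope mu y * mix mu y))).
  exact: (integrableZl measurableT _ iB).
rewrite -RintegralB// -RintegralZl// /Phi -RintegralD//.
apply: le_Rintegral => //; first exact: (integrableD measurableT (iphi mu) iZ).
move=> y _.
have uz : 0 < mix zeta y / p y by rewrite divr_gt0// mixture_gt0.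
have um : 0 < mix mu y / p y by rewrite divr_gt0// mixture_gt0.
have := phi_tangent halpha um uz.
rewrite -(ler_pM2r (hp0 y)) -/(slope mu y); apply: le_trans.
rewrite le_eqVlt; apply/orP; left; apply/eqP; field.
by rewrite lt0r_neq0// subr_eq0 lt_eqF.
Qed.

(** * One step of the power descent *)

Section power_step.
Variables (eta kappa : R).
Hypotheses (heta0 : 0 < eta) (hkappa : kappa <= 0).

(** The unnormalised density of the update in terms of the score. The shift [(alpha - 1) * kappa] is
    a product of two nonpositive numbers, so the base stays positive. *)
Definition pscore mu t :=
  (score mu t + (alpha - 1) * kappa) `^ (eta / (1 - alpha)).

Let c0 : 0 <= (alpha - 1) * kappa.
Proof. by rewrite mulr_le0// subr_le0 ltW. Qed.

Lemma score_shift_gt0 mu t : 0 < score mu t + (alpha - 1) * kappa.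
Proof. by rewrite ltr_wpDr// score_gt0. Qed.

Lemma GammaE mu t :
  Gamma alpha eta (gradb nu k p alpha mu t + kappa) = pscore mu t.
Proof.
rewrite /Gamma /pscore gradbE; congr (_ `^ _).
by field; rewrite subr_eq0 lt_eqF.
Qed.

Lemma pscore_gt0 mu t : 0 < pscore mu t.
Proof. by rewrite powR_gt0// score_shift_gt0. Qed.

Lemma pscore_continuous mu : continuous (pscore mu).
Proof.
move=> t; apply: (@continuous_comp _ _ _
  (fun t => score mu t + (alpha - 1) * kappa) (fun x => x `^ (eta / (1 - alpha)))).
  by apply: cvgD; [exact: score_continuous|exact: cvg_cst].
by apply: continuous_powR_pos; exact: score_shift_gt0.
Qed.

Definition pmass mu := \int[mu]_t pscore mu t.

Lemma Gamma_massE mu : Gamma_mass nu k p alpha eta kappa mu = (pmass mu)%:E.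
Proof.
rewrite /Gamma_mass; under eq_integral do rewrite GammaE.
rewrite fineK//; apply: integrable_fin_num => //.
exact: continuous_integrable (@pscore_continuous mu).
Qed.

Lemma pmass_gt0 mu : 0 < pmass mu.
Proof.
have [t tP] := compact_argmin hcompact t0 (@pscore_continuous mu).
apply: (lt_le_trans (pscore_gt0 mu t)).
rewrite -[leLHS](Rintegral_probability_cst mu).
apply: le_Rintegral => //; last exact: continuous_integrable (@pscore_continuous mu).
exact: (@continuous_integrable mu (cst (pscore mu t)) (@cst_continuous _ _ _)).
Qed.

Definition pdensity mu t := pscore mu t / pmass mu.

Lemma pdensity_gt0 mu t : 0 < pdensity mu t.
Proof. by rewrite divr_gt0 ?pscore_gt0 ?pmass_gt0. Qed.

Lemma pdensity_continuous mu : continuous (pdensity mu).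
Proof.
by move=> t; apply: cvgM; [exact: pscore_continuous|exact: cvg_cst].
Qed.

Lemma Rintegral_pdensity mu : \int[mu]_t pdensity mu t = 1.
Proof.
rewrite RintegralZr//; last exact: continuous_integrable (@pscore_continuous mu).
by rewrite divff// lt0r_neq0// pmass_gt0.
Qed.

Lemma power_descentE mu A : power_descent nu k p alpha eta kappa mu A =
  (\int[mu]_(t in A) (pdensity mu t)%:E)%E.
Proof.
rewrite /power_descent Gamma_massE /=.
by under eq_integral do rewrite GammaE.
Qed.

Lemma power_descent_probability mu : exists mu' : probability T R,
  forall A, measurable A -> mu' A = power_descent nu k p alpha eta kappa mu A.
Proof.
have [|t||mu' mu'P] := @density_probability _ _ _ mu (pdensity mu).
- exact: is_borel_continuous_measurable (@pdensity_continuous mu).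
- exact: ltW (pdensity_gt0 mu t).
- have i1 := continuous_integrable mu (@pdensity_continuous mu).
  rewrite -[LHS](fineK (integrable_fin_num measurableT i1)).
  by congr EFin; exact: Rintegral_pdensity.
by exists mu' => A mA; rewrite power_descentE mu'P.
Qed.

(** The integrand in [Phi_descent] is bounded pointwise by a multiple of [h t - 1], which has
    integral zero because [h] is a probability density. *)
Lemma Phi_power_step mu mu' : eta <= 1 ->
  (forall A, measurable A -> mu' A = power_descent nu k p alpha eta kappa mu A) ->
  Phi mu' <= Phi mu.
Proof.
move=> eta1 mu'E; rewrite -subr_le0.
have mu'E' A : measurable A -> mu' A = (\int[mu]_(t in A) (pdensity mu t)%:E)%E.
  by move=> mA; rewrite (mu'E _ mA) power_descentE.
have ch := @pdensity_continuous mu.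
apply: le_trans (Phi_descent ch (@pdensity_gt0 mu) mu'E') _.
set h := pdensity mu; set s := (1 - alpha) / eta.
have a1 : 0 < 1 - alpha by rewrite subr_gt0.
(* [D] adds up the coefficients of two bounds: [powR_phi_le] for the power of [h], and [phi_ge] for
   the shift by [kappa], which enters with a minus sign. *)
pose D := (pmass mu `^ s - (alpha - 1) * kappa) / (alpha - 1).
have -> : 0 = \int[mu]_t (D * (h t - 1)).
  have ih := continuous_integrable mu ch.
  have i1 : mu.-integrable [set: T] (EFin \o cst 1).
    exact: (@continuous_integrable mu (cst 1) (@cst_continuous _ _ _)).
  rewrite RintegralZl//; last exact: (integrableB measurableT ih i1).
  by rewrite RintegralB// Rintegral_pdensity Rintegral_probability_cst subrr mulr0.
have ch1 : continuous (fun t => D * (h t - 1)).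
  move=> t; apply: cvgM; first exact: cvg_cst.
  by apply: cvgB; [exact: ch|exact: cvg_cst].
have cphi : continuous (fun t => phi alpha (h t) * score mu t).
  move=> t; apply: cvgM; last exact: score_continuous.
  apply: (@continuous_comp _ _ _ h (phi alpha)); first exact: ch.
  apply: continuous_phi; exact: pdensity_gt0.
apply: le_Rintegral => //; [exact: continuous_integrable..|].
move=> t _; have h0 : 0 < h t by exact: pdensity_gt0.
(* The definition of the density is inverted, which expresses the score by [h] itself. *)
have -> : score mu t = pmass mu `^ s * h t `^ s - (alpha - 1) * kappa.
  rewrite -powRM ?(ltW h0) ?(ltW (pmass_gt0 _))//.
  rewrite /h /pdensity mulrC divfK ?lt0r_neq0 ?pmass_gt0// /pscore -powRrM.
  rewrite (_ : _ * s = 1) ?powRr1 ?(ltW (score_shift_gt0 _ _))// ?addrK//.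
  by rewrite /s; field; rewrite !lt0r_neq0.
(* The bound [eta <= 1] enters here: it makes the exponent [s] large enough for [powR_phi_le]. *)
have s1 : 1 - alpha <= s by rewrite /s ler_pdivlMr// ler_piMr// ltW.
have /(ler_wpM2l (powR_ge0 (pmass mu) s)) := powR_phi_le halpha s1 h0.
have /(ler_wpM2l c0) := phi_ge halpha h0.
move=> H1 H2; have -> : D * (h t - 1) =
  pmass mu `^ s * ((h t - 1) / (alpha - 1)) -
  (alpha - 1) * kappa * ((h t - 1) / (alpha - 1)) by rewrite /D; ring.
apply: le_trans (lerB H2 H1).
by rewrite le_eqVlt; apply/orP; left; apply/eqP; ring.
Qed.



Lemma power_descent_seq_exists mu1 :
  exists mu_ : nat -> probability T R,
     power_descent_seq nu k p alpha eta kappa mu1 mu_.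
Proof.
have /choice[next nextP] := power_descent_probability.
by exists (fun n => iter n next mu1); split => // n A; exact: nextP.
Qed.

(** * Uniform convergence of the densities along the iterates *)

Section limit.
Variables (mustar : probability T R) (mu_ : nat -> probability T R).
Hypothesis hstep : forall (n : nat) (A : set T), measurable A ->
  mu_ n.+1 A = power_descent nu k p alpha eta kappa (mu_ n) A.
Hypothesis hweak : weakly_converges mu_ mustar.

Lemma weakly_converges_continuous (f : T -> R) : continuous f ->
  \int[mu_ n]_t f t @[n --> \oo] --> \int[mustar]_t f t.
Proof.
move=> cf; have [M fM] := compact_norm_bounded hcompact t0 cf.
apply: hweak => //; exists M; split; first exact: num_real.
by move=> x Mx t _; exact: le_trans (ltW Mx).
Qed.

Lemma slope_cvg y : slope (mu_ n) y @[n --> \oo] --> slope mustar y.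
Proof.
apply: (@cvg_comp _ _ _ (fun n => mix (mu_ n) y / p y)
  (fun x : R => x `^ (alpha - 1)) _ (nbhs (mix mustar y / p y))).
  by apply: cvgM; [exact: weakly_converges_continuous|exact: cvg_cst].
by apply: continuous_powR_pos; rewrite divr_gt0// mixture_gt0.
Qed.

(** A bound on the distance between the scores that is free of [t]; this is how pointwise
    convergence of the slopes in [y] becomes uniform convergence in [t]. *)
Let err n := \int[nu]_y (supT (k^~ y) * `|slope (mu_ n) y - slope mustar y|).

Let supk_ge0 y : 0 <= supT (k^~ y).
Proof. exact: le_trans (ltW (hk0 t0 y)) (le_supT hcompact t0 t0 (@hcont y)). Qed.

Let measurable_err n : measurable_fun [set: Y]
  (fun y => supT (k^~ y) * `|slope (mu_ n) y - slope mustar y|).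
Proof.
apply: measurable_funM.
  by apply: measurable_supT => // t; exact: measurable_k1.
apply: measurableT_comp => //.
by apply: measurable_funB; exact: measurable_slope.
Qed.

(** Both slopes lie between 0 and the same supremum, so their distance is at most that supremum,
    without a factor 2. *)
Let err_le n y :
  `|supT (k^~ y) * `|slope (mu_ n) y - slope mustar y| | <= Hsup y.
Proof.
rewrite normrM normr_id ger0_norm// ler_wpM2l// ler_norml.
have s0 mu := ltW (slope_gt0 mu y).
rewrite lerBlDr (le_trans (slope_le _ _)) ?lerDl// andbT.
by rewrite lerBrDr (le_trans _ (s0 _))// addrC subr_le0 slope_le.
Qed.

Let integrable_err n : nu.-integrable [set: Y]
  (EFin \o (fun y => supT (k^~ y) * `|slope (mu_ n) y - slope mustar y|)).
Proof.
exact: dominated_integrable (measurable_err n) integrable_Hsup (err_le n).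
Qed.

Let err_cvg : err n @[n --> \oo] --> 0.
Proof.
have -> : 0 = \int[nu]_y (0 : R) :> R by rewrite /Rintegral integral0.
apply: (@Rintegral_dominated_cvg _ _ _ nu _ _ Hsup) => //.
- move=> y; rewrite -[X in _ --> X](mulr0 (supT (k^~ y))).
  apply: cvgM; first exact: cvg_cst.
  apply/norm_cvg0P; rewrite -(subrr (slope mustar y)).
  by apply: cvgB; [exact: slope_cvg|exact: cvg_cst].
- exact: integrable_Hsup.
Qed.

Let score_dist n t : `|score (mu_ n) t - score mustar t| <= err n.
Proof.
have iw mu := integrable_weight mu t.
rewrite /score -RintegralB//.
apply: le_trans (le_normr_Rintegral _ _) _ => //.
  exact: (integrableB measurableT (iw (mu_ n)) (iw mustar)).
apply: le_Rintegral => //.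
  exact: (integrable_norm (integrableB measurableT (iw (mu_ n)) (iw mustar))).
move=> y _; rewrite -mulrBr normrM ler_wpM2r//.
by rewrite ger0_norm ?(ltW (hk0 _ _))// (le_supT hcompact t0 t (@hcont y)).
Qed.

(** The limit score has a positive lower bound [m], so [err n / m] bounds the relative error of the
    shifted scores, and [powR_dist_le] carries it through the power. That lemma asks for a relative
    error below 1, which holds only for large [n]. *)
Lemma pscore_uniform_cvg : exists2 q : nat -> R, q n @[n --> \oo] --> 0 &
  \forall n \near \oo, forall t, `|pscore (mu_ n) t - pscore mustar t| <= q n.
Proof.
have [m m0 mP] := score_lb mustar.
have [M MP] := compact_norm_bounded hcompact t0 (@pscore_continuous mustar).
have M0 : 0 <= M by exact: le_trans (MP t0).
pose r := eta / (1 - alpha); have r0 : 0 <= r.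
  by rewrite divr_ge0// ?subr_ge0 ltW.
pose D n := err n / m.
have cD : D n @[n --> \oo] --> 0.
  by rewrite -(mul0r m^-1); apply: cvgM; [exact: err_cvg|exact: cvg_cst].
have cpow (v : nat -> R) : v n @[n --> \oo] --> (1 : R) ->
    v n `^ r @[n --> \oo] --> (1 : R).
  move=> v1; rewrite -[X in _ --> X](congr1 (@^~ r) (@powR1 R)).
  apply: (@cvg_comp _ _ _ v (fun x : R => x `^ r) _ (nbhs (1 : R)) _ v1).
  exact: continuous_powR_pos.
exists (fun n => M * ((1 + D n) `^ r - (1 - D n) `^ r)).
  rewrite -(mulr0 M) -(subrr (1 : R)); apply: cvgM; first exact: cvg_cst.
  apply: cvgB; apply: cpow.
    by rewrite -[X in _ --> X]addr0; apply: cvgD => //; exact: cvg_cst.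
  by rewrite -[X in _ --> X]subr0; apply: cvgB => //; exact: cvg_cst.
have : \forall n \near \oo, D n < 1 by apply: (cvgr_lt (0 : R)).
apply: filterS => n Dn1 t.
have e0 : 0 <= err n by exact: le_trans (score_dist n t).
have D0 : 0 <= D n by rewrite divr_ge0// ltW.
have x0 := score_shift_gt0 mustar t; have xn0 := score_shift_gt0 (mu_ n) t.
have scale (a b : R) : 0 <= a -> m <= b -> a <= b * (a / m).
  by move=> a0 mb; rewrite mulrCA ler_peMr// ler_pdivlMr// mul1r.
have shift (a b c : R) : a + c - (b + c) = a - b by ring.
have eD : err n <= (score mustar t + (alpha - 1) * kappa) * D n.
  apply: scale; first exact: e0.
  by apply: (le_trans (mP t)); rewrite lerDl.
have dist : `|score (mu_ n) t + (alpha - 1) * kappa -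
    (score mustar t + (alpha - 1) * kappa)| <=
    (score mustar t + (alpha - 1) * kappa) * D n.
  by rewrite shift; exact: le_trans (score_dist n t) eD.
apply: le_trans (powR_dist_le r0 x0 xn0 D0 Dn1 dist) _.
apply: ler_wpM2r; last by apply: le_trans (MP t); exact: ler_norm.
rewrite subr_ge0; apply: ge0_ler_powR => //; rewrite ?nnegrE.
- by rewrite subr_ge0 ltW.
- by rewrite addr_ge0.
by rewrite lerD2l (le_trans _ D0)// oppr_le0.
Qed.

(** Integrand and measure vary together: [F n - G] contributes at most [q n] under any probability
    measure, and weak convergence handles the fixed [G]. *)
Lemma weakly_converges_uniform (F : nat -> T -> R) (G : T -> R) (q : nat -> R) :
  (forall n, continuous (F n)) -> continuous G -> q n @[n --> \oo] --> 0 ->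
  (\forall n \near \oo, forall t, `|F n t - G t| <= q n) ->
  \int[mu_ n]_t F n t @[n --> \oo] --> \int[mustar]_t G t.
Proof.
move=> cF cG q0 FG.
rewrite -[X in _ --> X]add0r.
have -> : (fun n => \int[mu_ n]_t F n t) =
    (fun n => (\int[mu_ n]_t F n t - \int[mu_ n]_t G t) + \int[mu_ n]_t G t).
  by apply/funext => n; rewrite subrK.
apply: cvgD; last exact: weakly_converges_continuous.
apply/norm_cvg0P.
apply: (@squeeze_cvgr _ _ _ _ (fun=> 0) q) => //; last exact: cvg_cst.
apply: filterS FG => n FGn; rewrite normr_ge0/=.
have cd : continuous (fun t => F n t - G t).
  by move=> t; apply: cvgB; [exact: cF|exact: cG].
rewrite -RintegralB//; [|exact: continuous_integrable..].
apply: le_trans (le_normr_Rintegral _ _) _ => //; first exact: continuous_integrable.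
rewrite -[leRHS](Rintegral_probability_cst (mu_ n)).
apply: le_Rintegral => //.
- exact: integrable_norm (continuous_integrable _ cd).
- exact: (@continuous_integrable _ (cst (q n)) (@cst_continuous _ _ _)).
Qed.

(** * The weak limit is a fixed point *)

Lemma pmass_cvg : pmass (mu_ n) @[n --> \oo] --> pmass mustar.
Proof.
have [q q0 qP] := pscore_uniform_cvg.
exact: (weakly_converges_uniform (fun n => @pscore_continuous (mu_ n))
  (@pscore_continuous mustar) q0 qP).
Qed.

(* [pscore mustar] is integrated against both sides of the recursion. *)
Lemma pscore_square_integral :
  \int[mustar]_t (pscore mustar t * pscore mustar t) = pmass mustar ^+ 2.
Proof.
have [q q0 qP] := pscore_uniform_cvg.
have cG := @pscore_continuous mustar.
have [M MP] := compact_norm_bounded hcompact t0 cG.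
have H : \int[mu_ n]_t (pscore mustar t * pscore (mu_ n) t) @[n --> \oo] -->
    \int[mustar]_t (pscore mustar t * pscore mustar t).
  apply: (@weakly_converges_uniform _ _ (fun n => M * q n)).
  - by move=> n t; apply: cvgM; [exact: cG|exact: pscore_continuous].
  - by move=> t; apply: cvgM; exact: cG.
  - by rewrite -(mulr0 M); apply: cvgM => //; exact: cvg_cst.
  - by apply: filterS qP => n qn t; rewrite -mulrBr normrM ler_pM.
(* [pscore (mu_ n)] is its mass times the density of [mu_ n.+1] with respect to [mu_ n], so the
   product integral becomes one over the next iterate. *)
have E n : \int[mu_ n]_t (pscore mustar t * pscore (mu_ n) t) =
    \int[mu_ n.+1]_t pscore mustar t * pmass (mu_ n).
  have cd := @pdensity_continuous (mu_ n).
  rewrite (@Rintegral_density _ _ _ (mu_ n) (mu_ n.+1) (pdensity (mu_ n)) _ M)//.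
  - rewrite -RintegralZr//.
      apply: eq_Rintegral => t _; rewrite /pdensity -mulrA divfK//.
      by rewrite lt0r_neq0// pmass_gt0.
    apply: (@continuous_integrable _ (fun t => pscore mustar t * pdensity (mu_ n) t)).
    by move=> t; apply: cvgM; [exact: cG|exact: cd].
  - exact: is_borel_continuous_measurable.
  - by move=> t; apply: ltW; exact: pdensity_gt0.
  - by move=> A mA; rewrite (hstep _ mA) power_descentE.
  - exact: is_borel_continuous_measurable.
move: H; under eq_fun do rewrite E; move=> H.
(* The same sequence also tends to the squared mass: both factors converge to [pmass mustar], the
   first along the shifted index. *)
apply: (cvg_unique (@norm_hausdorff _ R^o) H).
rewrite expr2; apply: cvgM; last exact: pmass_cvg.
have := weakly_converges_continuous cG.
by rewrite -(cvg_shiftS (fun n => \int[mu_ n]_t pscore mustar t)).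
Qed.

(** The second moment under [mustar] equals the squared mean, so the variance is zero. *)
Lemma pscore_ae_eq :
  ae_eq mustar [set: T] (EFin \o pscore mustar) (cst (pmass mustar)%:E).
Proof.
have cG := @pscore_continuous mustar; set Z := pmass mustar.
have cGG : continuous (fun t => pscore mustar t * pscore mustar t).
  by move=> t; apply: cvgM; exact: cG.
have cD : continuous (fun t => (pscore mustar t - Z) * (pscore mustar t - Z)).
  by move=> t; apply: cvgM; (apply: cvgB; [exact: cG|exact: cvg_cst]).
have cL : continuous (fun t => (2 * Z) * pscore mustar t - Z * Z).
  move=> t; apply: cvgB; last exact: cvg_cst.
  by apply: cvgM; [exact: cvg_cst|exact: cG].
have iD := continuous_integrable mustar cD.
have I0 : \int[mustar]_t ((pscore mustar t - Z) * (pscore mustar t - Z)) = 0.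
  transitivity (\int[mustar]_t (pscore mustar t * pscore mustar t -
      ((2 * Z) * pscore mustar t - Z * Z))).
    by apply: eq_Rintegral => t _; ring.
  have i2 : mustar.-integrable [set: T] (EFin \o (fun t => (2 * Z) * pscore mustar t)).
    exact: (integrableZl measurableT _ (continuous_integrable mustar cG)).
  have i3 : mustar.-integrable [set: T] (EFin \o cst (Z * Z)).
    exact: (@continuous_integrable _ (cst (Z * Z)) (@cst_continuous _ _ _)).
  rewrite RintegralB//; [|exact: continuous_integrable..].
  rewrite RintegralB// RintegralZl//; last exact: continuous_integrable.
  rewrite Rintegral_probability_cst pscore_square_integral -/(pmass mustar) -/Z.
  ring.
have : (\int[mustar]_t `|((pscore mustar t - Z) * (pscore mustar t - Z))%R%:E| = 0)%E.
  under eq_integral do rewrite /= ger0_norm -?expr2 ?sqr_ge0// expr2.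
  by rewrite -[LHS](fineK (integrable_fin_num measurableT iD)) [fine _]I0.
move/(ae_eq_integral_abs _ measurableT (measurable_int _ iD)).
apply: filterS => t /(_ I) /=/eqP; rewrite eqe mulf_eq0 orbb subr_eq0 => /eqP ->.
by [].
Qed.

Lemma power_descent_limit_fixed (A : set T) : measurable A ->
  power_descent nu k p alpha eta kappa mustar A = mustar A.
Proof.
move=> mA; rewrite power_descentE -[RHS]mul1e -integral_cst//.
apply: ae_eq_integral => //.
  apply/measurable_EFinP/measurable_funTS.
  exact: is_borel_continuous_measurable (@pdensity_continuous mustar).
apply: filterS pscore_ae_eq => t /(_ I) /= [Zt] _.
by rewrite /pdensity Zt divff// lt0r_neq0// pmass_gt0.
Qed.

(** * Superlevel sets of the limit density and minimality of the limit *)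

Let Z := pmass mustar.

Let upset_measurable (x : R) : measurable [set t | x <= pscore mustar t].
Proof.
have mG := is_borel_continuous_measurable hborel (@pscore_continuous mustar).
have := mG measurableT `[x, +oo[%classic (measurable_itv _).
by rewrite setTI /preimage /=; under eq_set do rewrite in_itv/= andbT.
Qed.

Let step_ge n (A : set T) (l : R) : measurable A ->
  (forall t, A t -> l <= pdensity (mu_ n) t) -> 0 <= l ->
  (l%:E * mu_ n A <= mu_ n.+1 A)%E.
Proof.
move=> mA lA l0; rewrite (hstep _ mA) power_descentE -integral_cst//.
apply: ge0_le_integral => //.
- apply/measurable_EFinP/measurable_funTS.
  exact: is_borel_continuous_measurable (@pdensity_continuous (mu_ n)).
Qed.

(** The density of a step has a positive minimum on the compact space, so a set of positive mass
    keeps positive mass; null sets can thus be traced back to the initial measure. *)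
Let step_eq0 n (A : set T) : measurable A -> mu_ n.+1 A = 0 -> mu_ n A = 0.
Proof.
move=> mA A0.
have [t tP] := compact_argmin hcompact t0 (@pdensity_continuous (mu_ n)).
have l0 := pdensity_gt0 (mu_ n) t.
have := step_ge mA (fun x _ => tP x) (ltW l0); rewrite A0.
by rewrite pmule_rle0 ?lte_fin// measure_le0 => /eqP.
Qed.

(** From some rank on, each step multiplies the mass of the set by at least [1 + e]. Masses are at
    most 1, so the set is null at that rank, and then at rank 0. *)
Lemma superlevel_null (e : R) : 0 < e ->
  mu_ 0%N [set t | (1 + 2 * e) * Z <= pscore mustar t] = 0.
Proof.
move=> e0; set A := [set t | _]; have mA : measurable A by exact: upset_measurable.
have Z0 : 0 < Z := pmass_gt0 mustar.
have [q q0 qP] := pscore_uniform_cvg.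
(* The margin between [e] and [2 * e] absorbs both the uniform error [q n] and the difference
   between the masses. *)
have : \forall n \near \oo, (1 + e) * pmass (mu_ n) + q n <= (1 + 2 * e) * Z.
  apply: (cvgr_le ((1 + e) * Z)).
    rewrite -[X in _ --> X]addr0; apply: cvgD => //.
    by apply: cvgM; [exact: cvg_cst|exact: pmass_cvg].
  by rewrite ltr_pM2r// ltrD2l mulr_natl mulr2n ltrDl.
move=> hq; have [N _ NP] := filterI hq qP.
have grow n : (N <= n)%N -> ((1 + e)%:E * mu_ n A <= mu_ n.+1 A)%E.
  move=> /NP[/= hn qn]; apply: (step_ge mA); last by rewrite addr_ge0// ltW.
  move=> t At; rewrite /pdensity ler_pdivlMr; last exact: pmass_gt0.
  have := qn t; rewrite ler_distl => /andP[+ _]; apply: le_trans.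
  by rewrite lerBrDr (le_trans hn).
have e1 : 0 < 1 + e by rewrite addr_gt0.
have pow j : (((1 + e) ^+ j)%:E * mu_ N A <= mu_ (N + j) A)%E.
  elim: j => [|j IH]; first by rewrite expr0 mul1e addn0.
  rewrite addnS (le_trans _ (grow _ (leq_addr _ _)))// exprS EFinM -muleA.
  by rewrite lee_pmul2l// lte_fin.
have NA0 : mu_ N A = 0.
  have fN : mu_ N A \is a fin_num by exact: fin_num_measure.
  rewrite -(fineK fN); congr EFin; apply/eqP; rewrite eq_le fine_ge0// andbT.
  rewrite leNgt; apply/negP => x0.
  have : \forall j \near \oo, ((1 + e)^-1) ^+ j < fine (mu_ N A).
    apply: (cvgr_lt (0 : R)) => //; apply: cvg_expr.
    by rewrite ger0_norm ?invr_ge0 ?(ltW e1)// invf_lt1// ltrDl.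
  move=> [j _ /(_ j (leqnn j))/=]; rewrite ltNge => /negP; apply.
  rewrite exprVn -[leRHS]div1r ler_pdivlMr ?exprn_gt0// -lee_fin mulrC EFinM fineK//.
  by apply: le_trans (pow j) _; exact: probability_le1.
(* Nullity descends from rank [N] to rank 0 one step at a time. *)
by elim: N NA0 {NP grow pow} => // n IH /(step_eq0 mA).
Qed.


(** The strict superlevel set is covered by the countably many null sets obtained for [e] equal to
    [j.+1%:R^-1]. *)
Lemma pscore_ae_le :
  (mu_ 0%N).-negligible [set t | Z < pscore mustar t].
Proof.
pose A (j : nat) := [set t | (1 + 2 * j.+1%:R^-1) * Z <= pscore mustar t].
have Z0 : 0 < Z := pmass_gt0 mustar.
apply: (@negligibleS _ _ _ _ (\bigcup_j A j)); last first.
  apply: negligible_bigcup => j; exists (A j); split => //.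
    exact: upset_measurable.
  by apply: superlevel_null; rewrite invr_gt0.
move=> t /= Zt.
(* This is the value of [e] for which [(1 + 2 * e) * Z] is exactly [pscore mustar t]; any smaller
   inverse will do. *)
have gap : 0 < (pscore mustar t / Z - 1) / 2.
  by rewrite divr_gt0// subr_gt0 ltr_pdivlMr// mul1r.
have [j] := ltr_add_invr gap.
rewrite add0r => hj; exists j => //; rewrite /A /= -ler_pdivlMr//.
by rewrite -lerBrDl mulrC -ler_pdivlMr// ltW.
Qed.

Lemma score_pscoreE mu t : score mu t =
  pscore mu t `^ ((1 - alpha) / eta) - (alpha - 1) * kappa.
Proof.
have a1 : 0 < 1 - alpha by rewrite subr_gt0.
rewrite /pscore -powRrM (_ : eta / (1 - alpha) * ((1 - alpha) / eta) = 1).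
  by rewrite powRr1 ?addrK// ltW// score_shift_gt0.
by field; rewrite !lt0r_neq0.
Qed.

(** The score is an increasing function of [pscore]. It therefore equals a constant [gamma] almost
    everywhere under [mustar], and is at most [gamma] outside a set that is null for [mu_ 0] and
    hence for [zeta]. *)
Lemma score_limit_le zeta : zeta `<< mu_ 0%N ->
  \int[zeta]_t score mustar t <= \int[mustar]_t score mustar t.
Proof.
move=> zmu; pose gamma := Z `^ ((1 - alpha) / eta) - (alpha - 1) * kappa.
have cs := @score_continuous mustar.
have ms := is_borel_continuous_measurable hborel cs.
have gammaE : \int[mustar]_t score mustar t = gamma.
  rewrite -[RHS](Rintegral_probability_cst mustar) /Rintegral; congr fine.
  apply: ae_eq_integral => //; first exact/measurable_EFinP.
  apply: filterS pscore_ae_eq => t /(_ I) /= [Zt] _.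
  by rewrite score_pscoreE Zt.
have gamma0 : 0 <= gamma.
  by rewrite -gammaE; apply: Rintegral_ge0 => t _; exact: ltW (score_gt0 _ _).
rewrite gammaE -[leRHS](Rintegral_probability_cst zeta) /Rintegral fine_le//.
- exact: integrable_fin_num (continuous_integrable zeta cs).
- by rewrite integral_probability_cst.
apply: ae_ge0_le_integral => //.
- by move=> t _; rewrite lee_fin ltW ?score_gt0.
- exact/measurable_EFinP.
have [N [mN N0 sN]] := pscore_ae_le; exists N; split => //.
  by apply: (proj1 (null_content_dominatesP _ _) zmu).
apply: subset_trans sN => t /=; apply: contra_notP => /negP.
rewrite -leNgt => le _; rewrite lee_fin score_pscoreE lerD2r.
apply: ge0_ler_powR le; last by rewrite nnegrE; exact: ltW (pmass_gt0 _).
  by rewrite divr_ge0 ?subr_ge0 ?(ltW halpha) ?(ltW heta0).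
by rewrite nnegrE; exact: ltW (pscore_gt0 _ _).
Qed.

(** The linear term of [Phi_tangent] is nonnegative, being the product of the negative factor
    [(alpha - 1)^-1] and a nonpositive difference. *)
Lemma Phi_limit_le zeta : zeta `<< mu_ 0%N -> Phi mustar <= Phi zeta.
Proof.
move=> /score_limit_le h; apply: le_trans (Phi_tangent mustar zeta).
by rewrite lerDl mulr_le0// ?invr_le0 subr_le0// ltW.
Qed.

Lemma Phi_cvg : Phi (mu_ n) @[n --> \oo] --> Phi mustar.
Proof.
have [B iB hB] := phi_mixture_dominated.
apply: (@Rintegral_dominated_cvg _ _ _ nu _ _ B) => //.
- move=> n; apply/measurable_EFinP; exact: measurable_int (integrable_phi_mixture _).
- apply/measurable_EFinP; exact: measurable_int (integrable_phi_mixture _).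
move=> y; apply: cvgM; last exact: cvg_cst.
apply: (@cvg_comp _ _ _ (fun n => mix (mu_ n) y / p y) (phi alpha) _
  (nbhs (mix mustar y / p y))).
  by apply: cvgM; [exact: weakly_converges_continuous|exact: cvg_cst].
by apply: continuous_phi; rewrite divr_gt0// mixture_gt0.
Qed.

Lemma iterate_dominated n : mu_ n `<< mu_ 0%N.
Proof.
apply/null_content_dominatesP; elim: n => // n IH A mA /(IH A mA) A0.
rewrite (hstep _ mA) power_descentE; apply: null_set_integral => //.
apply/measurable_EFinP/measurable_funTS.
exact: is_borel_continuous_measurable (@pdensity_continuous (mu_ n)).
Qed.

Lemma Psi_nonincreasing : eta <= 1 ->
  nonincreasing_seq (fun n => Psi nu k p alpha (mu_ n)).
Proof.
move=> eta1; apply/nonincreasing_seqP => n; rewrite !PsiE lee_fin lerD2r.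
exact: Phi_power_step eta1 (hstep n).
Qed.

Lemma Psi_limit_inf : Psi nu k p alpha mustar =
  ereal_inf [set Psi nu k p alpha zeta |
             zeta in [set z : probability T R | z `<< mu_ 0%N]].
Proof.
apply/eqP; rewrite eq_le; apply/andP; split.
  apply: le_ereal_inf_tmp => _ [zeta /= zmu <-].
  by rewrite !PsiE lee_fin lerD2r; exact: Phi_limit_le.
(* Domination of [mustar] by the initial measure is not established, so [mustar] cannot be used as a
   competitor. The iterates are dominated, and their values converge to that of [mustar]. *)
set I := ereal_inf _.
have le_I n : (I <= Psi nu k p alpha (mu_ n))%E.
  by apply: ereal_inf_lbound; exists (mu_ n) => //; exact: iterate_dominated.
have cPsi : Psi nu k p alpha (mu_ n) @[n --> \oo] --> Psi nu k p alpha mustar.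
  rewrite PsiE; under eq_fun do rewrite PsiE.
  apply: cvg_EFin; first exact: nearW.
  by apply: cvgD; [exact: Phi_cvg|exact: cvg_cst].
rewrite -(cvg_lim _ cPsi)//; apply: lime_ge; first exact: cvgP cPsi.
exact: nearW.
Qed.

End limit.
End power_step.

End power_descent_theory.

(** On an empty space the total mass would be 0. The point obtained serves as the base point [t0] of
    the compactness arguments. *)
Lemma probability_inhabited (d : measure_display) (T : measurableType d)
    (R : realType) (mu : probability T R) : exists t : T, True.
Proof.
apply: contrapT => T0; have := integral_probability_cst mu 1.
rewrite (_ : [set: T] = set0) ?integral_set0.
  by move/eqP; rewrite eq_sym onee_eq0.
by apply/seteqP; split => // t; exfalso; apply: T0; exists t.
Qed.

Theorem theorem4 (R : realType) (d dY : measure_display)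
    (T : measurableMetricType d R) (Y : measurableType dY)
    (nu : {sigma_finite_measure set Y -> \bar R})
    (k : T -> Y -> R) (p : Y -> R) (alpha kappa : R) (Dom : interval R)
    (hk : kernel_density nu k)
    (hp : measurable_fun [set: Y] p)
    (hk0 : forall (t : T) (y : Y), 0 < k t y)
    (hp0 : forall y : Y, 0 < p y)
    (hpint : (\int[nu]_y (p y)%:E < +oo)%E)
    (halpha : alpha < 1)
    (hkappa : kappa <= 0)
    (hDomb : forall (mu : probability T R) (t : T),
      gradb nu k p alpha mu t + kappa \in Dom)
    (hDommub : forall mu : probability T R,
      \int[mu]_t gradb nu k p alpha mu t + kappa \in Dom)
    (hDom : forall v : R, v \in Dom ->
      (alpha - 1) * kappa <= (alpha - 1) * v + 1)
    (hcompact : compact [set: T])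
    (hborel : is_borel T)
    (hcont : forall y : Y, continuous (fun t : T => k t y))
    (hsup : (\int[nu]_y (ereal_sup [set (k t y)%:E | t in [set: T]] *
      ereal_sup [set ((k t y / p y) `^ (alpha - 1))%:E | t in [set: T]])
      < +oo)%E)
    (hlog : alpha = 0 ->
      (\int[nu]_y (ereal_sup [set `|ln (k t y / p y)|%:E | t in [set: T]] *
        (p y)%:E) < +oo)%E) :
  (forall zeta : probability T R,
    (forall eta : R, 0 < eta ->
      (Gamma_mass nu k p alpha eta kappa zeta < +oo)%E) /\
    (Psi nu k p alpha zeta < +oo)%E) /\
  (forall eta : R, 0 < eta -> eta <= 1 ->
    (forall mu1 : probability T R, exists mu_ : nat -> probability T R,
      power_descent_seq nu k p alpha eta kappa mu1 mu_) /\
    (forall (mu1 mustar : probability T R) (mu_ : nat -> probability T R),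
      power_descent_seq nu k p alpha eta kappa mu1 mu_ ->
      weakly_converges mu_ mustar ->
      [/\ nonincreasing_seq (fun n : nat => Psi nu k p alpha (mu_ n)),
          (forall A : set T, measurable A ->
            power_descent nu k p alpha eta kappa mustar A = mustar A)
        & Psi nu k p alpha mustar =
          ereal_inf [set Psi nu k p alpha zeta |
                     zeta in [set z : probability T R | z `<< mu1]]])).
Proof.
split.
  move=> zeta; have [t0 _] := probability_inhabited zeta; split.
    move=> eta eta0; rewrite (Gamma_massE hk hp hk0 hp0 halpha hcompact hborel
      hcont hsup t0 eta hkappa zeta).
    exact: ltry.
  rewrite (PsiE hk hp hk0 hp0 hpint halpha hcompact hcont hsup hlog t0 zeta).
  exact: ltry.
move=> eta eta0 eta1; split.
  move=> mu1; have [t0 _] := probability_inhabited mu1.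
  exact: (power_descent_seq_exists hk hp hk0 hp0 halpha hcompact hborel hcont
    hsup t0 eta hkappa mu1).
move=> mu1 mustar mu_ [<- hstep] hweak.
have [t0 _] := probability_inhabited mustar; split.
- exact: (Psi_nonincreasing hk hp hk0 hp0 hpint halpha hcompact hborel hcont
    hsup hlog t0 eta0 hkappa hstep eta1).
- exact: (power_descent_limit_fixed hk hp hk0 hp0 halpha hcompact hborel hcont
    hsup t0 eta0 hkappa hstep hweak).
- exact: (Psi_limit_inf hk hp hk0 hp0 hpint halpha hcompact hborel hcont hsup
    hlog t0 eta0 hkappa hstep hweak).
Qed.
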